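(* Let $n\ge2$, and let $\tilde\phi:\mathbb C[\tilde Z]\to\mathbb P_e$ be the $S$-algebra isomorphism given by $\tilde\phi(z_{k,k+p})=j_{\tau^kc_p}/j_{\tau^{k-1}}$ for $1\le k\le k+p\le n$. Then for all $0\le k\le n$ and all partitions $\lambda=(\lambda_1,\dots,\lambda_k)$ (with at most $k$ parts) with $\lambda_1\le n-k$, $$\tilde\phi(z_{\lambda,k})=j_{\tau^kw_\lambda^{\mathrm{af}}}.$$ In particular $$\tilde\phi(D_i)=j_{t_{-\omega_i^\vee}}\quad(0\le i\le n-1),\qquad \tilde\phi(D_i')=j_{s_it_{-\omega_i^\vee}}\quad(1\le i\le n-1).$$
   Context: **Coefficients.** $S=\mathbb C[a_1,\dots,a_n]/(a_1+\dots+a_n)$, indices of $a_i$ read modulo $n$; $F=\mathrm{Frac}(S)$. **Centralizer family.** Let $\mathfrak h$ be the diagonal Cartan subalgebra of $\mathfrak{sl}_n$, $E$ the matrix with $1$'s on the superdiagonal and zeros elsewhere, $B\subset SL_n$ the upper triangular Borel subgroup, and $\tilde Z=\{(h,b)\in\mathfrak h\times B\mid b(-E+h)b^{-1}=-E+h\}$. With $z_{ij}$ the matrix entries of $b$ ($z_{ij}=0$ for $i>j$), $\mathbb C[\tilde Z]$ is the $S$-algebra generated by $z_{ij}$ ($1\le i\le j\le n$) modulo $z_{11}\cdots z_{nn}=1$ and $z_{ij}=z_{i-1,j-1}+(a_{i-1}-a_j)z_{i-1,j}$ for $2\le i\le j\le n$. **Minors.** For a partition $\lambda=(\lambda_1\ge\dots\ge\lambda_k\ge0)$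 with $\lambda_1\le n-k$, $z_{\lambda,k}=\det(z_{p,\lambda_{k+1-q}+q})_{1\le p,q\le k}$, the minor of $(z_{ij})$ in the first $k$ rows and columns $\lambda_k+1,\lambda_{k-1}+2,\dots,\lambda_1+k$. $R_i$ is the rectangular partition with $n-i$ rows and $i$ columns, $R_i-1$ is $R_i$ with one cell removed from the last column, $D_i=z_{R_i,n-i}$ and $D_i'=z_{R_i-1,n-i}$. **Extended affine Weyl group.** $W=S_n$ with simple reflections $s_1,\dots,s_{n-1}$; $Q^\vee=\{\lambda\in\mathbb Z^n:\sum\lambda_i=0\}$; $P^\vee$ is spanned by $\omega_k^\vee=(1^k,0^{n-k})-\frac kn(1^n)$, $\omega_0^\vee=0$. $W_e=W\ltimes P^\vee$ with translations $t_\lambda$; $W_{\mathrm{af}}=W\ltimes Q^\vee$ is a Coxeter group with generators $s_0,\dots,s_{n-1}$, $s_0=t_{(1,0,\dots,0,-1)}\cdot(1\,n)$. $\tau=t_{\omega_1^\vee}s_1s_2\cdots s_{n-1}\in W_e$ satisfies $\tau^n=1$, $\tau s_i\tau^{-1}=s_{i+1}$ (mod $n$), $W_e=\langle\tau\rangle\ltimes W_{\mathrm{af}}$; $\ell(\tau^rw):=\ell(w)$ for $w\in W_{\mathrm{af}}$. $c_p=s_{p-1}\cdots s_1s_0$, $c_0=\mathrm{id}$. For $\lambda$ with $\lambda_1<n$, $w_\lambda^{\mathrm{af}}=u_{\ell(\lambda)}\cdots u_2u_1$ with $u_i=s_{\lambda_i-i}s_{\lambda_i-i-1}\cdots s_{1-i}$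 (subscripts mod $n$), and $w_\emptyset^{\mathrm{af}}=\mathrm{id}$. (For $k=0$ the only partition is $\emptyset$, $z_{\emptyset,0}=1$; for $k=n$ the only partition is $\emptyset$.) $W_e$ acts on $F$ with $W$ permuting the $a_i$ and $t_\lambda$ acting trivially. **NilHecke and Peterson algebras.** In the twisted group algebra $\bigoplus_{w\in W_e}Fw$, $(pv)(qw)=p(v\cdot q)vw$, let $\alpha_i=a_i-a_{i+1}$ ($i\in\mathbb Z/n$), $A_i=\alpha_i^{-1}(s_i-1)$, $A_w=A_{i_1}\cdots A_{i_\ell}$ for a reduced word $w=s_{i_1}\cdots s_{i_\ell}\in W_{\mathrm{af}}$, $A_{\tau^rw}=\tau^rA_w$. $\mathbb A_e=\bigoplus_{w\in W_e}SA_w$, and $\mathbb P_e$ is the centralizer of $S$ in $\mathbb A_e$, a commutative $S$-algebra. With $W_e^0=\{w\in W_e\mid\ell(wv)>\ell(w)\ \forall v\in W\setminus\{\mathrm{id}\}\}$, $\{j_w\mid w\in W_e^0\}$ is the unique $S$-basis of $\mathbb P_e$ with $j_w\in A_w+\sum_{x\in W_e\setminus W_e^0}SA_x$. Under the known isomorphism $H_T(\mathrm{Gr}_{PGL_n})\cong\mathbb P_e$, $j_w$ is the Schubert class of $w$. The $j_{\tau^k}$ are units in $\mathbb P_e$. *)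

(* Defs.v *)
From HB Require Import structures.
From mathcomp Require Import all_boot all_order all_algebra fingroup perm.
From mathcomp Require Import generic_quotient ring_quotient fraction.
From mathcomp Require Import boolp finmap monalg mpoly.

Set Implicit Arguments.
Unset Strict Implicit.
Unset Printing Implicit Defensive.

Import GRing.Theory.

Local Open Scope ring_scope.
Local Open Scope quotient_scope.

(* Throughout, n >= 2 is written m.+2 and indices modulo n are elements of the
   ring 'I_m.+2 = Z/n; the index n is therefore 0 there.  K is the ground field
   (the complex numbers in the main statement). *)

Section GenIdeal.
Variables (A : comNzRingType) (G : A -> Prop).

Definition gen_ideal : {pred A} := fun x => `[< exists s : seq (A * A),
  (forall p, p \in s -> G p.2) /\ x = \sum_(p <- s) p.1 * p.2 >].

Lemma gen_ideal_gen x : G x -> x \in gen_ideal.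
Proof.
move=> Gx; apply/asboolP; exists [:: (1, x)]; rewrite big_seq1 /= mul1r.
by split=> // p; rewrite inE => /eqP ->.
Qed.

Lemma gen_ideal0 : 0 \in gen_ideal.
Proof. by apply/asboolP; exists [::]; rewrite big_nil. Qed.

Lemma gen_ideal_lin a : {in gen_ideal &, forall u v, a * u + v \in gen_ideal}.
Proof.
move=> _ _ /asboolP [s [Gs ->]] /asboolP [t [Gt ->]]; apply/asboolP.
exists ([seq (a * p.1, p.2) | p <- s] ++ t); split=> [p|].
  by rewrite mem_cat => /orP[/mapP[q /Gs Gq ->] //|/Gt].
rewrite big_cat big_map mulr_sumr; congr (_ + _).
by apply: eq_bigr => p _ /=; rewrite mulrA.
Qed.

Lemma gen_ideal_ker (B : comNzRingType) (f : {rmorphism A -> B}) :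
  (forall x, G x -> f x = 0) -> forall x, x \in gen_ideal -> f x = 0.
Proof.
move=> fG x /asboolP [s [Gs ->]]; rewrite rmorph_sum big_seq big1 // => p sp.
by rewrite rmorphM /= (fG p.2) ?mulr0 //; apply: Gs.
Qed.

Lemma gen_ideal_closed (B : comNzRingType) (f : {rmorphism A -> B}) :
  (forall x, G x -> f x = 0) -> idealr_closed gen_ideal.
Proof.
move=> fG; split; [exact: gen_ideal0 | | exact: gen_ideal_lin].
by apply/negP => /(gen_ideal_ker fG)/eqP; rewrite rmorph1 oner_eq0.
Qed.

End GenIdeal.

Section CoefficientRing.
Variables (K : fieldType) (m : nat).
Local Notation n := m.+2.
Local Notation KX := {mpoly K[n]}.

(* coefS = K[a_1, ..., a_n] / (a_1 + ... + a_n) *)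
Definition lin_sum : KX := \sum_(i < n) 'X_i.

Definition sumIdeal : KX -> bool := gen_ideal (fun p => p = lin_sum).

(* Substitution of -(a_1 + ... + a_(n-1)) for the variable of index 0. *)
Definition elim_tuple : n.-tuple KX :=
  [tuple (if i == 0 :> 'I_n then 'X_i - lin_sum else 'X_i) | i < n].
Definition elim_var : {rmorphism KX -> KX} := comp_mpoly elim_tuple.

Fact elim_var_lin p : p = lin_sum -> elim_var p = 0.
Proof.
move=> ->; rewrite /elim_var /lin_sum rmorph_sum /= (bigD1 ord0) //=.
rewrite comp_mpolyXU -tnth_nth tnth_mktuple eqxx.
rewrite [X in _ + X](_ : _ = \sum_(i < n | i != ord0) 'X_i); last first.
  by apply: eq_bigr => i /negPf i0; rewrite comp_mpolyXU -tnth_nth tnth_mktuple i0.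
by rewrite /lin_sum (bigD1 (ord0 : 'I_n)) //= -/lin_sum addrAC subrr.
Qed.

HB.instance Definition _ := isIdealr.Build KX sumIdeal (gen_ideal_closed elim_var_lin).

Local Notation Q := {ideal_quot Idealr.clone KX sumIdeal _}.

Fact pi_elim_var p : \pi_Q (elim_var p) = \pi_Q p.
Proof.
have pZ c q : \pi_Q (c *: q) = \pi_Q c%:MP * \pi_Q q.
  by rewrite -mul_mpolyC rmorphM.
rewrite /elim_var /= comp_mpolyE [in RHS](mpolyE p) !rmorph_sum /=; apply: eq_bigr => u _.
rewrite !pZ mpolyXE_id; congr (_ * _); rewrite !rmorph_prod.
apply: eq_bigr => i _; rewrite !rmorphXn /= tnth_mktuple.
case: ifP => // _; rewrite rmorphB /=; congr (_ ^+ _).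
suff -> : \pi_Q lin_sum = 0 by rewrite subr0.
apply/eqP; rewrite -[0](rmorph0 (\pi_Q)) eqmodE /= Quotient.equivE subr0.
exact: gen_ideal_gen.
Qed.

Lemma sumIdeal_prime : prime_idealr_closed sumIdeal.
Proof.
have IE p : (p \in sumIdeal) = (elim_var p == 0).
  apply/idP/eqP => [|sp0]; first exact: gen_ideal_ker elim_var_lin p.
  have e0 : \pi_Q p = \pi_Q 0 by rewrite -pi_elim_var sp0.
  have : (p == 0 %[mod Q])%qT by apply/eqP.
  by rewrite -Quotient.idealrBE subr0.
by move=> u v; rewrite !IE rmorphM mulf_eq0.
Qed.

HB.instance Definition _ := isPrimeIdealrClosed.Build KX sumIdeal sumIdeal_prime.


Definition coefS : Type := {ideal_quot PrimeIdealr.clone KX sumIdeal _}.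

HB.instance Definition _ := GRing.ComNzRing.on coefS.

(* The quotient carries no decidable inverse, so units and inverses are chosen
   classically; only the integral domain structure matters below. *)
Definition coefS_unit : {pred coefS} := fun x => `[< exists y, y * x = 1 >].

Definition coefS_inv (x : coefS) : coefS :=
  if pselect (exists y, y * x = 1) is left e then projT1 (cid e) else x.

Fact coefS_mulVx : {in coefS_unit, left_inverse 1 coefS_inv *%R}.
Proof.
move=> x /asboolP e; rewrite /coefS_inv; case: pselect => // e'.
by case: (cid e').
Qed.

Fact coefS_unitPl x y : y * x = 1 -> coefS_unit x.
Proof. by move=> e; apply/asboolP; exists y. Qed.

Fact coefS_inv_out : {in [predC coefS_unit], coefS_inv =1 id}.
Proof.
by move=> x /asboolPn ne; rewrite /coefS_inv; case: pselect => // /ne.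
Qed.

HB.instance Definition _ := GRing.ComNzRing_hasMulInverse.Build coefS
  coefS_mulVx coefS_unitPl coefS_inv_out.

Fact coefS_mulf_eq0 : GRing.integral_domain_axiom coefS.
Proof. by move=> x y /Quotient.rquot_IdomainAxiom. Qed.

HB.instance Definition _ :=
  GRing.ComUnitRing_isIntegral.Build coefS coefS_mulf_eq0.

Definition a_ (i : 'I_n) : coefS := \pi_coefS 'X_i.


(* s permutes the variables: actS s (a_ i) = a_ (s i), see actS_a. *)
Definition actS (s : 'S_n) (x : coefS) : coefS := \pi_coefS (msym s (repr x)).

Lemma actS_pi s p : actS s (\pi_coefS p) = \pi_coefS (msym s p).
Proof.
apply/eqP; rewrite -Quotient.idealrBE -msymB.
have : repr (\pi_coefS p) - p \in sumIdeal.
  by rewrite Quotient.idealrBE reprK.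
move=> /asboolP [t [Gt ->]]; apply/asboolP.
exists [seq (msym s q.1, msym s q.2) | q <- t]; split=> [q|].
  case/mapP=> q' /Gt e -> /=; rewrite e; rewrite /lin_sum rmorph_sum /=.
  rewrite [RHS](reindex_inj (@perm_inj _ s)) /=; apply: eq_bigr => i _.
  by rewrite /msym mmapX mmap1U.
by rewrite rmorph_sum big_map; apply: eq_bigr => q _ /=; rewrite msymM.
Qed.

Lemma actS_a s i : actS s (a_ i) = a_ (s i).
Proof. by rewrite actS_pi /msym mmapX mmap1U. Qed.

Fact actS_zmod s : zmod_morphism (actS s).
Proof.
move=> x y; rewrite -[x]reprK -[y]reprK -rmorphB !actS_pi msymB.
exact: rmorphB.
Qed.

Fact actS_monoid s : monoid_morphism (actS s).
Proof.
split=> [|x y].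
  by rewrite -(rmorph1 (\pi_coefS)) actS_pi msym1.
rewrite -[x]reprK -[y]reprK -rmorphM !actS_pi msymM.
exact: rmorphM.
Qed.

HB.instance Definition _ s :=
  GRing.isZmodMorphism.Build coefS coefS (actS s) (actS_zmod s).
HB.instance Definition _ s :=
  GRing.isMonoidMorphism.Build coefS coefS (actS s) (actS_monoid s).

Lemma actS1 x : actS 1%g x = x.
Proof. by rewrite -[x]reprK actS_pi msym1m. Qed.

Lemma actSM s t x : actS (s * t)%g x = actS t (actS s x).
Proof. by rewrite -[x]reprK !actS_pi msymMm reprK. Qed.

End CoefficientRing.

Notation tofrac := (@FracField.tofrac _).
Notation "x %:F" := (tofrac x) : ring_scope.

Section FracMap.
Variables A : idomainType.

Lemma frac_reprE (x : {fraction A}) :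
  x = (frac (repr x)).1%:F / (frac (repr x)).2%:F.
Proof.
have d0 : (frac (repr x)).2%:F != 0 :> {fraction A}.
  by rewrite tofrac_eq0 denom_ratioP.
apply: (mulIf d0); rewrite divfK //.
rewrite -{1}[x]reprK; unlock FracField.tofrac.
rewrite -[LHS]FracField.pi_mul; apply/eqmodP => /=.
rewrite /equivf /FracField.mulf /=.
by rewrite !numden_Ratio ?mulf_neq0 ?oner_eq0 ?denom_ratioP // !mulr1 mulrC.
Qed.

Definition frac_map (f : A -> A) (x : {fraction A}) : {fraction A} :=
  (f (frac (repr x)).1)%:F / (f (frac (repr x)).2)%:F.

Variables (f : {rmorphism A -> A}) (f_inj : injective f).

Fact frac_map_neq0 d : d != 0 -> (f d)%:F != 0 :> {fraction A}.
Proof. by move=> d0; rewrite tofrac_eq0 -(rmorph0 f) (inj_eq f_inj). Qed.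

Lemma frac_map_frac p d : d != 0 ->
  frac_map f (p%:F / d%:F) = (f p)%:F / (f d)%:F.
Proof.
move=> d0; rewrite /frac_map; set x := p%:F / d%:F.
have dx0 := denom_ratioP (repr x).
apply/eqP; rewrite eqr_div ?frac_map_neq0 // -!tofracM -!rmorphM tofrac_eq.
rewrite (inj_eq f_inj) -tofrac_eq !tofracM -eqr_div ?tofrac_eq0 //.
by rewrite -frac_reprE.
Qed.

Lemma frac_mapE p : frac_map f p%:F = (f p)%:F.
Proof.
by rewrite -[in LHS](divr1 p%:F) -tofrac1 frac_map_frac ?oner_eq0 // rmorph1 tofrac1 divr1.
Qed.

Lemma frac_map_zmod : zmod_morphism (frac_map f).
Proof.
move=> x y; rewrite [x]frac_reprE [y]frac_reprE.
move: (denom_ratioP (repr x)) (denom_ratioP (repr y)).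
move: (frac (repr x)) (frac (repr y)) => [p d] [q e] /= d0 e0.
rewrite -mulNr addf_div ?tofrac_eq0 // -tofracN -!tofracM -tofracD.
rewrite !frac_map_frac ?mulf_neq0 // rmorphD !rmorphM rmorphN /=.
by rewrite tofracD !tofracM tofracN -addf_div ?frac_map_neq0 // mulNr.
Qed.

Lemma frac_map_monoid : monoid_morphism (frac_map f).
Proof.
split=> [|x y]; first by rewrite -tofrac1 frac_mapE rmorph1.
rewrite [x]frac_reprE [y]frac_reprE.
move: (denom_ratioP (repr x)) (denom_ratioP (repr y)).
move: (frac (repr x)) (frac (repr y)) => [p d] [q e] /= d0 e0.
rewrite mulf_div -!tofracM !frac_map_frac ?mulf_neq0 //.
by rewrite !rmorphM /= mulf_div.
Qed.

End FracMap.

Section WeylActionOnFractions.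
Variables (K : fieldType) (m : nat).
Local Notation n := m.+2.
Local Notation F := {fraction coefS K m}.

Definition actF (s : 'S_n) : F -> F := frac_map (actS s).

Fact actS_inj s : injective (@actS K m s).
Proof.
by apply: (can_inj (g := @actS K m s^-1%g)) => x; rewrite -actSM mulgV actS1.
Qed.

HB.instance Definition _ s := GRing.isZmodMorphism.Build F F (actF s)
  (frac_map_zmod (@actS_inj s)).
HB.instance Definition _ s := GRing.isMonoidMorphism.Build F F (actF s)
  (frac_map_monoid (@actS_inj s)).

Lemma actF_frac s p : actF s p%:F = (actS s p)%:F.
Proof. exact/frac_mapE/actS_inj. Qed.

Lemma actF1 x : actF 1%g x = x.
Proof. by rewrite /actF /frac_map !actS1 -frac_reprE. Qed.

Lemma actFM s t x : actF (s * t)%g x = actF t (actF s x).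
Proof.
rewrite [x]frac_reprE; move: (denom_ratioP (repr x)); move: (frac (repr x)) => [p d] /= d0.
have d1 : actS s d != 0 by rewrite -(rmorph0 (actS s)) (inj_eq (@actS_inj s)).
have e u (q e : coefS K m) (e0 : e != 0) := frac_map_frac (@actS_inj u) q e0.
rewrite /actF (e s _ _ d0) (e (s * t)%g _ _ d0) (e t _ _ d1).
by move=> /=; rewrite (actSM s t p) (actSM s t d).
Qed.

End WeylActionOnFractions.

Section Coweights.
Variable m : nat.
Local Notation n := m.+2.
Local Notation V := 'rV[rat]_n.

(* Coordinates are indexed by Z/n, so the last coordinate of Q^n sits at the
   index 0; for k < n the first k coordinates are therefore those at the
   indices i with 0 < i <= k. *)
Definition omega_vec (k : 'I_n) : V :=
  \row_i ((0 < i <= k)%N%:R - k%:R / n%:R).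

Definition in_coweight : {pred V} := fun v =>
  `[< exists c : 'I_n -> int, v = \sum_(k < n) omega_vec k *~ c k >].

Fact in_coweight_zmod : zmod_closed in_coweight.
Proof.
split=> [|_ _ /asboolP [c ->] /asboolP [d ->]]; apply/asboolP.
  by exists (fun=> 0); rewrite big1.
exists (fun k => c k - d k); rewrite -sumrB.
by apply: eq_bigr => k _; rewrite mulrzBr.
Qed.
HB.instance Definition _ := GRing.isZmodClosed.Build V in_coweight
  in_coweight_zmod.

Lemma omega_vec_in k : omega_vec k \in in_coweight.
Proof.
apply/asboolP; exists (fun i => (i == k)%:Z); rewrite (bigD1 k) //= eqxx.
by rewrite big1 ?addr0 // => i /negPf ->.
Qed.

Definition eps_vec (k : 'I_n) : V := \row_i ((i == k)%:R - n%:R^-1).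

Fact eps_vec_in k : eps_vec k \in in_coweight.
Proof.
have nn : n%:R != 0 :> rat by rewrite Num.Theory.pnatr_eq0.
case: (unliftP ord0 k) => [j|] ->.
  pose k' : 'I_n := widen_ord (leqnSn _) j.
  suff -> : eps_vec (lift ord0 j) = omega_vec (lift ord0 j) - omega_vec k'.
    by rewrite rpredB ?omega_vec_in.
  apply/rowP => i; rewrite !mxE /= /bump leq0n add1n.
  have -> : (i == lift ord0 j)%:R = (0 < i <= j.+1)%N%:R - (0 < i <= j)%N%:R :> rat.
    rewrite -val_eqE /= /bump leq0n add1n [(i <= j.+1)%N]leq_eqVlt ltnS.
    by case: eqP => [->|_] /=; rewrite ?ltnn ?subr0 ?subrr.
  have e2 : n%:R^-1 = j.+1%:R / n%:R - j%:R / n%:R :> rat.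
    by rewrite -mulrBl -natrB ?leqnSn // subSnn mul1r.
  rewrite [in LHS]e2 !opprB [LHS]addrACA [RHS]addrACA.
  by congr (_ + _); rewrite addrC.
have -> : eps_vec ord0 = - omega_vec ord_max.
  apply/rowP => i; rewrite !mxE /= (_ : (i <= m.+1)%N) ?andbT ?opprB -1?ltnS //.
  have -> : m.+1%:R / n%:R = 1 - n%:R^-1 :> rat.
    by rewrite -[m.+1%:R]addr0 -(subrr 1) addrA natr1 mulrBl divff // mul1r.
  rewrite addrAC; congr (_ - _); rewrite -val_eqE /=.
  by case: (nat_of_ord i) => [|?] /=; rewrite ?subr0 ?subrr.
by rewrite rpredN omega_vec_in.
Qed.

Lemma omega_vecE k : omega_vec k = \sum_(i < n | (0 < i <= k)%N) eps_vec i.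
Proof.
apply/rowP => i; rewrite summxE !mxE.
under eq_bigr do rewrite mxE.
rewrite sumrB sumr_const -[X in _ = _ - X]mulr_natl; congr (_ - _).
  have [ik|ik] := boolP (0 < i <= k)%N.
    rewrite (bigD1 i) //= eqxx big1 ?addr0 // => j /andP [_ ji].
    by rewrite eq_sym (negPf ji).
  rewrite big1 // => j jk; case: eqP => // ij.
  by rewrite ij jk in ik.
congr (_%:R * _); rewrite -sum1_card big_mkcond /=.
rewrite -(big_mkord xpredT (fun i => if (0 < i <= k)%N then 1%N else 0%N)).
rewrite (@big_cat_nat _ _ _ k.+1) //= big_ltn // ltnn /= add0n.
rewrite [X in (_ + X)%N]big_nat_cond [X in (_ + X)%N]big1 ?addn0 => [|j].
  rewrite (@eq_big_nat _ _ _ _ _ _ (fun=> 1%N)) => [|j].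
    by rewrite sum_nat_const_nat muln1 subn1.
  by rewrite ltnS => ->.
by rewrite andbT => /andP [kj _]; rewrite [(j <= k)%N]leqNgt kj andbF.
Qed.

(* The coordinate v_i moves to position s i. *)
Definition perm_vec (s : 'S_n) (v : V) : V := \row_i v 0 (s^-1%g i).

Fact perm_vec_zmod s : zmod_morphism (perm_vec s).
Proof. by move=> u v; apply/rowP => i; rewrite !mxE. Qed.
HB.instance Definition _ s := GRing.isZmodMorphism.Build V V (perm_vec s)
  (perm_vec_zmod s).

Lemma perm_vec1 v : perm_vec 1 v = v.
Proof. by apply/rowP => i; rewrite mxE invg1 perm1. Qed.

Lemma perm_vecM s t v : perm_vec (s * t)%g v = perm_vec t (perm_vec s v).
Proof. by apply/rowP => i; rewrite !mxE invMg permM. Qed.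

Fact perm_vec_eps s k : perm_vec s (eps_vec k) = eps_vec (s k).
Proof.
apply/rowP => i; rewrite !mxE; congr (_%:R - _).
by rewrite -(inj_eq (@perm_inj _ s)) permKV.
Qed.

Fact perm_vec_in s v : v \in in_coweight -> perm_vec s v \in in_coweight.
Proof.
move=> /asboolP [c ->]; rewrite raddf_sum rpred_sum // => k _ /=.
rewrite raddfMz rpredMz // omega_vecE raddf_sum rpred_sum // => i _ /=.
by rewrite perm_vec_eps eps_vec_in.
Qed.

Record coweight := Coweight { coweight_val :> V; _ : coweight_val \in in_coweight }.
HB.instance Definition _ := [isSub for coweight_val].
HB.instance Definition _ := [Choice of coweight by <:].
HB.instance Definition _ := [SubChoice_isSubZmodule of coweight by <:].

Definition omega k : coweight := Coweight (omega_vec_in k).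
Definition eps k : coweight := Coweight (eps_vec_in k).
Definition perm_coweight (s : 'S_n) (v : coweight) : coweight :=
  Coweight (perm_vec_in s (valP v)).

Fact perm_coweight_zmod s : zmod_morphism (perm_coweight s).
Proof. by move=> u v; apply: val_inj; rewrite /= raddfB. Qed.
HB.instance Definition _ s := GRing.isZmodMorphism.Build coweight coweight
  (perm_coweight s) (perm_coweight_zmod s).

Lemma perm_coweight1 v : perm_coweight 1 v = v.
Proof. by apply: val_inj; rewrite /= perm_vec1. Qed.

Lemma perm_coweightM s t v :
  perm_coweight (s * t)%g v = perm_coweight t (perm_coweight s v).
Proof. by apply: val_inj; rewrite /= perm_vecM. Qed.

End Coweights.

Section ExtendedAffineWeylGroup.
Variable m : nat.
Local Notation n := m.+2.

(* ExtW v s is t_v s. *)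
Record extW := ExtW { ext_tr : coweight m; ext_perm : 'S_n }.

Definition extW_pair w := (ext_tr w, ext_perm w).
Definition pair_extW p := ExtW p.1 p.2.
Fact extW_pairK : cancel extW_pair pair_extW. Proof. by case. Qed.
HB.instance Definition _ := Choice.copy extW (can_type extW_pairK).

(* Permutations are composed as functions, (s t)(i) = s (t i), whereas the
   product of {perm _} composes from left to right. *)
Definition extW_mul (v w : extW) : extW :=
  ExtW (ext_tr v + perm_coweight (ext_perm v) (ext_tr w))
       (ext_perm w * ext_perm v)%g.
Definition extW_one : extW := ExtW 0 1%g.
Definition extW_inv (w : extW) : extW :=
  ExtW (- perm_coweight (ext_perm w)^-1%g (ext_tr w)) (ext_perm w)^-1%g.

Fact extW_mulA : associative extW_mul.
Proof.
move=> u v w; rewrite /extW_mul /= raddfD /= addrA mulgA.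
by rewrite perm_coweightM.
Qed.
Fact extW_mul1 : left_id extW_one extW_mul.
Proof.
by case=> v s; rewrite /extW_mul /= add0r perm_coweight1 mulg1.
Qed.
Fact extW_1mul : right_id extW_one extW_mul.
Proof. by case=> v s; rewrite /extW_mul /= raddf0 addr0 mul1g. Qed.
Fact extW_mulV : left_inverse extW_one extW_inv extW_mul.
Proof. by case=> v s; rewrite /extW_mul /= addNr mulgV. Qed.
Fact extW_Vmul : right_inverse extW_one extW_inv extW_mul.
Proof.
case=> v s; rewrite /extW_mul /= raddfN /= -perm_coweightM mulVg.
by rewrite perm_coweight1 subrr.
Qed.

HB.instance Definition _ := isGroup.Build extW extW_mulA extW_mul1 extW_1mul
  extW_mulV extW_Vmul.

End ExtendedAffineWeylGroup.

Record field_action (F : fieldType) (W : groupType) := FieldAction {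
  fa_act : W -> {rmorphism F -> F};
  fa_act1 : forall p, fa_act 1%g p = p;
  fa_actM : forall v w p, fa_act (v * w)%g p = fa_act v (fa_act w p)
}.

Section TwistedGroupAlgebra.
Variables (F : fieldType) (W : groupType) (act : field_action F W).
Local Notation tw := {malg F[W]}.
Local Notation supp := (@monalg.msupp W F).
Local Notation U := (@mkmalgU W F).
Local Notation cf := (@monalg.mcoeff W F).

Local Notation actW := (fa_act act).

Definition tw_mul (g h : tw) : tw :=
  \sum_(v <- supp g) \sum_(w <- supp h)
    U (v * w)%g (cf v g * actW v (cf w h)).

Local Open Scope fset_scope.

Fact tw_mulw (d1 d2 : {fset W}) g h : supp g `<=` d1 -> supp h `<=` d2 ->
  tw_mul g h = \sum_(v <- d1) \sum_(w <- d2)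
    U (v * w)%g (cf v g * actW v (cf w h)).
Proof.
move=> le1 le2; rewrite /tw_mul (big_fset_incl _ le1) /=.
  apply/eq_bigr=> v _; apply/big_fset_incl => // w _ /monalg.mcoeff_outdom ->.
  by rewrite rmorph0 mulr0 raddf0.
move=> v _ /monalg.mcoeff_outdom e.
by rewrite big1 // => w _; rewrite e mul0r raddf0.
Qed.

Fact tw_mulDl : left_distributive tw_mul +%R.
Proof.
move=> g1 g2 h.
rewrite (tw_mulw (monalg.msuppD_le g1 g2) (fsubset_refl _)).
rewrite (tw_mulw (fsubsetUl _ (supp g2)) (fsubset_refl (supp h))).
rewrite (tw_mulw (fsubsetUr (supp g1) _) (fsubset_refl (supp h))).
rewrite -big_split /=; apply/eq_bigr=> v _.
rewrite -big_split /=; apply/eq_bigr=> w _.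
by rewrite raddfD /= mulrDl raddfD.
Qed.

Fact tw_mulDr : right_distributive tw_mul +%R.
Proof.
move=> h g1 g2.
rewrite (tw_mulw (fsubset_refl _) (monalg.msuppD_le g1 g2)).
rewrite (tw_mulw (fsubset_refl (supp h)) (fsubsetUl _ (supp g2))).
rewrite (tw_mulw (fsubset_refl (supp h)) (fsubsetUr (supp g1) _)).
rewrite -big_split /=; apply/eq_bigr=> v _.
rewrite -big_split /=; apply/eq_bigr=> w _.
by rewrite raddfD rmorphD /= mulrDr raddfD.
Qed.

Fact tw_mul0l : left_zero 0 tw_mul.
Proof. by move=> g; apply: (addrI (tw_mul 0 g)); rewrite -tw_mulDl !addr0. Qed.

Fact tw_mul0r : right_zero 0 tw_mul.
Proof. by move=> g; apply: (addrI (tw_mul g 0)); rewrite -tw_mulDr !addr0. Qed.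

Fact tw_mulUU v w p q :
  tw_mul (U v p) (U w q) = U (v * w)%g (p * actW v q).
Proof.
by rewrite (tw_mulw monalg.msuppU_le monalg.msuppU_le) !big_seq_fset1
  !monalg.mcoeffUU.
Qed.

Fact tw_mul_suml (I : Type) (r : seq I) (P : I -> tw) h :
  tw_mul (\sum_(i <- r) P i) h = \sum_(i <- r) tw_mul (P i) h.
Proof.
exact: (big_morph (tw_mul^~ _) (fun _ _ => tw_mulDl _ _ _) (tw_mul0l _)).
Qed.

Fact tw_mul_sumr (I : Type) (r : seq I) (P : I -> tw) h :
  tw_mul h (\sum_(i <- r) P i) = \sum_(i <- r) tw_mul h (P i).
Proof.
exact: (big_morph (tw_mul _) (fun _ _ => tw_mulDr _ _ _) (tw_mul0r _)).
Qed.

Fact tw_mulA : associative tw_mul.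
Proof.
move=> x y z; rewrite (monalg.monalgE x) (monalg.monalgE y) (monalg.monalgE z).
rewrite !tw_mul_suml; apply: eq_bigr => u _.
rewrite [LHS]tw_mul_sumr [X in _ = tw_mul X _]tw_mul_sumr [RHS]tw_mul_suml.
apply: eq_bigr => v _.
rewrite [X in tw_mul _ X = _]tw_mul_sumr [LHS]tw_mul_sumr [RHS]tw_mul_sumr.
apply: eq_bigr => w _.
by rewrite !tw_mulUU rmorphM /= fa_actM mulgA mulrA.
Qed.

Fact tw_mul1l : left_id (U 1%g 1) tw_mul.
Proof.
move=> x; rewrite [in LHS](monalg.monalgE x) tw_mul_sumr [RHS]monalg.monalgE.
by apply: eq_bigr => w _; rewrite tw_mulUU mul1g mul1r fa_act1.
Qed.

Fact tw_mul1r : right_id (U 1%g 1) tw_mul.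
Proof.
move=> x; rewrite [in LHS](monalg.monalgE x) tw_mul_suml [RHS]monalg.monalgE.
by apply: eq_bigr => w _; rewrite tw_mulUU mulg1 rmorph1 mulr1.
Qed.

Fact tw_1_neq0 : U 1%g 1 != 0.
Proof. by rewrite monalg.monalgU_eq0 oner_eq0. Qed.

Fact tw_scaleU p v q : p *: U v q = U v (p * q).
Proof.
by apply/malgP => w; rewrite monalg.mcoeffZ !monalg.mcoeffU mulrnAr.
Qed.

Fact tw_scaleAl (p : F) (x y : tw) : p *: tw_mul x y = tw_mul (p *: x) y.
Proof.
rewrite (monalg.monalgE x) tw_mul_suml !scaler_sumr tw_mul_suml.
apply: eq_bigr => v _; rewrite (monalg.monalgE y).
rewrite [X in _ *: X]tw_mul_sumr [RHS]tw_mul_sumr scaler_sumr.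
by apply: eq_bigr => w _; rewrite tw_scaleU !tw_mulUU tw_scaleU mulrA.
Qed.

(* Finitely supported functions W -> F, with (p v)(q w) = p (v.q) vw. *)
Definition twisted_alg of field_action F W : Type := tw.
Local Notation tA := (twisted_alg act).

HB.instance Definition _ := GRing.Lmodule.copy tA tw.
HB.instance Definition _ := GRing.Zmodule_isNzRing.Build tA
  tw_mulA tw_mul1l tw_mul1r tw_mulDl tw_mulDr tw_1_neq0.

HB.instance Definition _ := GRing.Lmodule_isLalgebra.Build F tA tw_scaleAl.

Definition grp (w : W) : tA := U w 1.

Lemma grpM v w : grp v * grp w = grp (v * w)%g.
Proof. by rewrite /grp [LHS]tw_mulUU rmorph1 mulr1. Qed.

Lemma grp_scale w (p : F) : grp w * p%:A = actW w p *: grp w.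
Proof.
rewrite /grp [p%:A]tw_scaleU [LHS]tw_mulUU [RHS]tw_scaleU.
by rewrite mulg1 mulrC !mulr1.
Qed.

End TwistedGroupAlgebra.

Arguments grp {F W} act w.

Section WeylAction.
Variables (K : fieldType) (m : nat).

Definition fracS : fieldType := {fraction coefS K m}.

(* Translations act trivially on F. *)
Definition weyl_act (w : extW m) : {rmorphism fracS -> fracS} :=
  @actF K m (ext_perm w).

Fact weyl_act1 p : weyl_act 1%g p = p. Proof. exact: actF1. Qed.

Fact weyl_actM v w p : weyl_act (v * w)%g p = weyl_act v (weyl_act w p).
Proof. exact: actFM. Qed.

Definition weyl_action : field_action fracS (extW m) :=
  FieldAction weyl_act1 weyl_actM.

End WeylAction.

Notation twalg K m := (twisted_alg (weyl_action K m)).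

Section NilHecke.
Variables (K : fieldType) (m : nat).
Local Notation n := m.+2.
Local Notation W := (extW m).
Local Notation S := (coefS K m).
Local Notation tw := (twalg K m).

Definition transl (v : coweight m) : W := ExtW v 1%g.

(* s_i for i in Z/n; eps 1 - eps 0 is (1, 0, ..., 0, -1). *)
Definition simple (i : 'I_n) : W :=
  ExtW (if i == 0 then eps 1 - eps 0 else 0) (tperm i (i + 1)).

Definition word (s : seq 'I_n) : W := (\prod_(i <- s) simple i)%g.

(* s_1 s_2 ... s_(n-1) *)
Definition cox : W := word [seq i%:R | i <- iota 1 m.+1].

Definition tau : W := (transl (omega 1%R) * cox)%g.

(* W_e is the semidirect product of <tau> and the Coxeter group W_af, so all the
   decompositions w = tau^r u with u in W_af have the same u, and the shortest
   words s below are the reduced words of that u. *)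
Definition is_dec (w : W) (d : nat * seq 'I_n) : Prop :=
  w = (tau ^+ d.1 * word d.2)%g.

Definition is_reduced_dec (w : W) (d : nat * seq 'I_n) : Prop :=
  is_dec w d /\ forall d', is_dec w d' -> (size d.2 <= size d'.2)%N.

Definition reduced_dec (w : W) : nat * seq 'I_n :=
  if pselect (exists d, is_reduced_dec w d) is left e then projT1 (cid e)
  else (0, [::]).

Definition ell (w : W) : nat := size (reduced_dec w).2.

(* W_e^0; the finite Weyl group W is the set of the t_0 v. *)
Definition minW (w : W) : Prop :=
  forall v : 'S_n, v != 1%g -> (ell w < ell (w * ExtW 0%R v)%g)%N.

Definition alpha (i : 'I_n) : S := a_ K i - a_ K (i + 1).

Definition A_simple (i : 'I_n) : tw :=
  ((alpha i)%:F)^-1 *: (grp (weyl_action K m) (simple i) - 1).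

(* By the braid relations the choice of the reduced word is immaterial. *)
Definition A_ (w : W) : tw :=
  let d := reduced_dec w in grp (weyl_action K m) tau ^+ d.1 * \prod_(i <- d.2) A_simple i.

Definition Scomb (b : W -> tw) (ws : seq W) (c : W -> S) : tw :=
  \sum_(w <- ws) (c w)%:F *: b w.

Definition Sspan (P : W -> Prop) (b : W -> tw) (x : tw) : Prop :=
  exists (ws : seq W) (c : W -> S),
    (forall w, w \in ws -> P w) /\ x = Scomb b ws c.

(* Pe is a commutative subring of tw, on which S acts by s%:F *: x. *)
Definition Ae : tw -> Prop := Sspan (fun=> True) A_.

Definition Pe (x : tw) : Prop :=
  Ae x /\ forall s : S, s%:F%:A * x = x * s%:F%:A.

(* {j w | w in W_e^0} is the S-basis of P_e characterized by
   j w \in A_w + \sum_(x notin W_e^0) S A_x; j is irrelevant off W_e^0. *)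
Record peterson_basis (j : W -> tw) : Prop := PetersonBasis {
  pb_in : forall w, minW w -> Pe (j w);
  pb_lead : forall w, minW w -> Sspan (fun x => ~ minW x) A_ (j w - A_ w);
  pb_span : forall x, Pe x -> Sspan minW j x;
  pb_free : forall (ws : seq W) (c : W -> S),
    uniq ws -> (forall w, w \in ws -> minW w) -> Scomb j ws c = 0 ->
    forall w, w \in ws -> c w = 0
}.

(* c_p = s_(p-1) ... s_1 s_0 *)
Definition c_elt (p : nat) : W := word [seq i%:R | i <- rev (iota 0 p)].

(* u_i = s_(l-i) s_(l-i-1) ... s_(1-i), for the i-th part l of a partition *)
Definition u_word (i l : nat) : seq 'I_n :=
  [seq t%:R - i%:R | t <- rev (iota 1 l)].

(* u_k ... u_2 u_1; the null parts of lam contribute empty words. *)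
Definition w_af (lam : seq nat) : W :=
  word (flatten [seq u_word i (nth 0%N lam i.-1) | i <- rev (iota 1 (size lam))]).

End NilHecke.

Section CentralizerFamily.
Variables (S : comNzRingType) (m : nat) (a : 'I_m.+2 -> S).
Local Notation n := m.+2.
Local Notation ZP := {mpoly S[n * n]}.

(* Rows and columns are numbered from 1. *)
Definition zX (i j : nat) : ZP :=
  'X_(mxvec_index (inord i.-1 : 'I_n) (inord j.-1 : 'I_n)).

Inductive Zrel : ZP -> Prop :=
| Zrel_det : Zrel (\prod_(1 <= i < n.+1) zX i i - 1)
| Zrel_lower i j : (1 <= j < i)%N -> (i <= n)%N -> Zrel (zX i j)
| Zrel_comm i j : (2 <= i <= j)%N -> (j <= n)%N ->
    Zrel (zX i j
          - (zX i.-1 j.-1 + (a i.-1%:R - a j%:R)%:MP * zX i.-1 j)).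

Definition zIdeal : ZP -> bool := gen_ideal Zrel.

(* The identity matrix, a point of the family over S. *)
Definition ev1 : {rmorphism ZP -> S} :=
  meval (fun k => mxvec (1%:M : 'M[S]_n) 0 k).

Fact ev1_zX i j : (1 <= i <= n)%N -> (1 <= j <= n)%N ->
  ev1 (zX i j) = (i == j)%:R.
Proof.
move=> /andP [i1 i_n] /andP [j1 j_n]; rewrite /ev1 /= mevalXU mxvecE mxE.
rewrite -val_eqE /= !inordK ?prednK //.
by case: i i1 {i_n} => // i; case: j j1 {j_n}.
Qed.

Fact ev1_Zrel p : Zrel p -> ev1 p = 0.
Proof.
case=> [|i j /andP [j1 ji] i_n|i j /andP [i2 ij] j_n].
- rewrite rmorphB rmorph1 rmorph_prod big_nat big1 ?subrr // => i /andP [i1 i_n].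
  by rewrite ev1_zX ?i1 // eqxx.
- rewrite ev1_zX ?j1 ?(leq_trans (ltnW ji)) ?i_n ?andbT //.
    by rewrite gtn_eqF.
  exact: leq_ltn_trans ji.
have i1 : (0 < i.-1)%N by case: i i2 {ij} => [|[]].
have ij1 : (i.-1 < j)%N by apply: leq_trans ij; rewrite prednK // ltnW.
have i0 : (0 < i)%N by apply: ltnW.
have j0 : (0 < j)%N by apply: leq_trans ij.
have j1 : (0 < j.-1)%N by apply: (leq_trans i1); rewrite -!subn1 leq_sub2r.
have i_n : (i <= n)%N by apply: leq_trans ij j_n.
rewrite rmorphB rmorphD rmorphM /= !ev1_zX ?i0 ?j0 ?i1 ?j1 //=; last first.
- by rewrite (leq_trans (leq_pred _)).
- by rewrite (leq_trans (leq_pred _)).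
- by rewrite (leq_trans (leq_pred _)).
rewrite (ltn_eqF ij1) mulr0 addr0.
by rewrite -{1}(prednK i0) -{1}(prednK j0) eqSS subrr.
Qed.

Fact zIdeal_closed : idealr_closed zIdeal.
Proof. exact: (@gen_ideal_closed ZP Zrel S ev1 ev1_Zrel). Qed.

HB.instance Definition _ := isIdealr.Build ZP zIdeal zIdeal_closed.

Definition CZ : Type := {ideal_quot Idealr.clone ZP zIdeal _}.
HB.instance Definition _ := GRing.ComNzRing.on CZ.

Definition z_ (i j : nat) : CZ := \pi_CZ (zX i j).

Definition CZ_of_S (s : S) : CZ := \pi_CZ s%:MP.

(* lam = [:: lam_1; ...; lam_k], and nth 0 lam (k - q.+1) is lam_(k+1-(q+1)). *)
Definition zminor (lam : seq nat) (k : nat) : CZ :=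
  \det (\matrix_(p < k, q < k) z_ p.+1 (nth 0%N lam (k - q.+1) + q.+1)%N).

(* R_i has n - i rows and i columns; Rpart1 i is R_i without the last cell of
   its last column. *)
Definition Rpart (i : nat) : seq nat := nseq (n - i) i.

Definition Rpart1 (i : nat) : seq nat := rcons (nseq (n - i).-1 i) i.-1.

Definition D_ (i : nat) : CZ := zminor (Rpart i) (n - i).

Definition D'_ (i : nat) : CZ := zminor (Rpart1 i) (n - i).

End CentralizerFamily.

(* Main.v *)
(* The centralizer P_e lies in the commutative subalgebra E of elements supported
   on translations.  Let proj send p t_v s to p t_v.  If x is not minimal in x W,
   then A_x is a left multiple of some A_k with k <> 0 and proj (A_x) = 0; hence
   j_w = proj (A_w) for w in W_e^0.  With X_i = t_{eps_i} one has
   proj (tau^k) = X_1 ... X_k, and on E left multiplication by A_i followed by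
   proj is, for i <> 0, the divided difference D_i attached to the simultaneous
   exchange of a_i, a_{i+1} and of X_i, X_{i+1}.
   Moving tau^k to the right turns the letters of w_lambda into letters i <> 0,
   so j_{tau^k w_lambda} is obtained from X_1 ... X_k by such D_i, and each box of
   lambda contributes one of them.  On the other side, the relations among the
   z_ij show that the minors in the first k rows are also those of the matrix with
   entries M_{p,l} = D_{l-1} ... D_1 ((- a_1)^p X_1).  By the braid relation, column
   l of M is invariant under every exchange except the l-th, and D_l maps it to
   column l + 1, so D_i moves column i of a minor to i + 1: this is the effect of
   adding a box.  That A_s depends only on the element when s is reduced is
   Matsumoto's theorem, proved with alcove inversions; that the words of w_lambda
   are reduced and minimal follows from proj (A_s) <> 0, which is read off a
   leading coefficient. *)
Require Import Defs.
From HB Require Import structures.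
From mathcomp Require Import all_boot all_order all_algebra fingroup perm.
From mathcomp Require Import generic_quotient ring_quotient fraction.
From mathcomp Require Import boolp finmap monalg mpoly.
From mathcomp Require Import ring lra zify.
From mathcomp Require Import reals complex.

Set Implicit Arguments.
Unset Strict Implicit.
Unset Printing Implicit Defensive.

Import Order.TTheory GRing.Theory Num.Theory.

Local Open Scope ring_scope.

(** * Lengths in the extended affine Weyl group *)

Section CoweightCoordinates.
Variable m : nat.
Local Notation n := m.+2.
Implicit Types (u v : coweight m) (i j k : 'I_n).

Definition cwcoord v i : rat := coweight_val v 0 i.

Lemma cwcoord_inj u v : cwcoord u =1 cwcoord v -> u = v.
Proof. by move=> e; apply/val_inj/rowP => i; apply: e. Qed.

Lemma cwcoord0 i : cwcoord 0 i = 0.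
Proof. by rewrite /cwcoord mxE. Qed.

Lemma cwcoordD u v i : cwcoord (u + v) i = cwcoord u i + cwcoord v i.
Proof. by rewrite /cwcoord mxE. Qed.

Lemma cwcoordN v i : cwcoord (- v) i = - cwcoord v i.
Proof. by rewrite /cwcoord mxE. Qed.

Lemma cwcoord_sum (I : Type) (r : seq I) (P : pred I) (F : I -> coweight m) i :
  cwcoord (\sum_(x <- r | P x) F x) i = \sum_(x <- r | P x) cwcoord (F x) i.
Proof.
by apply: (big_morph (cwcoord^~ i)); [move=> u v; apply: cwcoordD | apply: cwcoord0].
Qed.

Lemma cwcoord_perm s v i : cwcoord (perm_coweight s v) i = cwcoord v (s^-1%g i).
Proof. by rewrite /cwcoord mxE. Qed.

Lemma cwcoord_eps k i : cwcoord (eps k) i = (i == k)%:R - n%:R^-1.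
Proof. by rewrite /cwcoord mxE. Qed.

Lemma perm_eps (s : 'S_n) k : perm_coweight s (eps k) = eps (s k).
Proof. by apply/val_inj/perm_vec_eps. Qed.

Lemma omega_eps k : omega k = \sum_(i < n | (0 < i <= k)%N) eps i.
Proof.
apply: val_inj; rewrite /= omega_vecE.
by elim/big_rec2: _ => // i u v _ ->.
Qed.

(** The constant [k/n] in each [omega_vec k] cancels in a difference of two coordinates. *)
Lemma cwcoord_diff_int v i j : exists z : int, cwcoord v i - cwcoord v j = z%:~R.
Proof.
have /asboolP [c e] := valP v.
exists (\sum_(k < n) ((0 < i <= k)%N%:Z - (0 < j <= k)%N%:Z) * c k).
rewrite /cwcoord e !summxE -sumrB rmorph_sum /=; apply: eq_bigr => k _.
rewrite -![(omega_vec k *~ c k) 0 _]/((omega_vec k *~ c k : 'M_(_,_)) 0 _).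
rewrite -scaler_int !mxE -mulrBr mulrC rmorphM rmorphB /=; congr (_ * _).
by rewrite -!pmulrn opprB addrA subrK.
Qed.

Lemma cwcoord_sum0 v : \sum_i cwcoord v i = 0.
Proof.
have epsS k : \sum_i ((eps_vec k : 'rV[rat]_n) 0 i) = 0.
  under eq_bigr do rewrite mxE.
  rewrite sumrB sumr_const card_ord -[X in _ - X]mulr_natl divff ?pnatr_eq0 //.
  by rewrite (bigD1 k) //= eqxx big1 ?addr0 ?subrr // => i /negPf ->.
have /asboolP [c e] := valP v.
rewrite /cwcoord e; under eq_bigr do rewrite summxE.
rewrite exchange_big big1 //= => k _.
under eq_bigr do rewrite -scaler_int mxE omega_vecE summxE.
rewrite -mulr_sumr exchange_big big1 ?mulr0 // => i _; exact: epsS.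
Qed.

End CoweightCoordinates.

Section AffineLength.
Variable m : nat.
Local Notation n := m.+2.
Local Notation W := (extW m).
Implicit Types (x y : W) (i j k l : 'I_n).

(* The representative of i in {1, ..., n}, minus 1; the index 0 stands for n. *)
Definition pos i : nat := nat_of_ord (i - 1)%R.

Lemma pos_inj : injective pos.
Proof. by move=> i j /val_inj /addIr. Qed.

Lemma pos_succ i : pos (i + 1) = i.
Proof. by rewrite /pos addrK. Qed.

Lemma posE i : pos i = if i == 0 then m.+1 else i.-1.
Proof.
have e : pos i = ((i + m.+1) %% n)%N.
  by rewrite /pos /= (modn_small (_ : 1 < n)%N) // subn1 (modn_small (_ : m.+1 < n)%N).
have [i0|i0] := eqVneq i 0; first by rewrite e i0 add0n modn_small.
have i1 : (0 < i)%N by rewrite lt0n.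
rewrite e -[in LHS](prednK i1) addSnnS modnDr modn_small //.
by rewrite (leq_ltn_trans (leq_pred _)).
Qed.

(* Signed number of hyperplanes parallel to e_i - e_j = 0 that separate the alcove
   of x from the fundamental one (a cocycle, trivial on tau). *)
Definition signed_inv x i j : rat :=
  cwcoord (ext_tr x) (ext_perm x j) - cwcoord (ext_tr x) (ext_perm x i)
  - (pos (ext_perm x j) < pos (ext_perm x i))%N%:R + (pos j < pos i)%N%:R.

Lemma ext_permM x y i : ext_perm (x * y)%g i = ext_perm x (ext_perm y i).
Proof. exact: permM. Qed.

Lemma ext_trM x y : ext_tr (x * y)%g = ext_tr x + perm_coweight (ext_perm x) (ext_tr y).
Proof. by []. Qed.

(** The comparison of the intermediate positions, those of the images under [y], occurs with both
    signs and cancels. *)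
Lemma signed_invM x y i j :
  signed_inv (x * y)%g i j = signed_inv x (ext_perm y i) (ext_perm y j) + signed_inv y i j.
Proof.
rewrite /signed_inv !ext_permM ext_trM !cwcoordD !cwcoord_perm !permK.
set a := (_ < _)%N; set b := (_ < _)%N; set c := (_ < _)%N.
by ring.
Qed.

Lemma signed_inv_sym x i j : signed_inv x j i = - signed_inv x i j.
Proof.
have [->|ij] := eqVneq i j; first by rewrite /signed_inv !subrr !ltnn; lra.
rewrite /signed_inv.
have e (p q : 'I_n) : p != q -> (pos q < pos p)%N%:R = 1 - (pos p < pos q)%N%:R :> rat.
  rewrite -(inj_eq pos_inj) neq_ltn => /orP[]h; rewrite h ltnNge (ltnW h) /=; lra.
by rewrite (e j i) 1?eq_sym // (e (ext_perm x j) (ext_perm x i)) ?(inj_eq perm_inj) 1?eq_sym //; lra.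
Qed.

Lemma signed_inv_int x i j : exists z : int, signed_inv x i j = z%:~R.
Proof.
have [z e] := cwcoord_diff_int (ext_tr x) (ext_perm x j) (ext_perm x i).
rewrite /signed_inv e; set a := (_ < _)%N; set b := (_ < _)%N.
by exists (z - a%:Z + b%:Z); rewrite rmorphD rmorphB.
Qed.

(** Integrality turns a negative value into one that is at most -1. This is what makes a descent
    lower the length by exactly one. *)
Lemma signed_inv_lt0 x i j : signed_inv x i j < 0 -> signed_inv x i j <= -1.
Proof.
have [z ->] := signed_inv_int x i j.
by rewrite -[-1]/((-1)%:~R) ltrz0 ler_int; lia.
Qed.

Lemma ext_permS k i : ext_perm (simple k) i = tperm k (k + 1) i.
Proof. by []. Qed.

Lemma succ_neq k : k + 1 != k.
Proof. by rewrite -subr_eq0 addrAC subrr add0r oner_eq0. Qed.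

Lemma simple2 k : (simple k * simple k)%g = 1%g.
Proof.
rewrite -[1%g]/(extW_one m) -[LHS]/(extW_mul _ _) /extW_mul /= tperm2; congr ExtW.
case: eqP => [->|_]; last by rewrite raddf0 addr0.
by rewrite raddfB /= !perm_eps add0r tpermL tpermR addrA subrK subrr.
Qed.

(** A simple reflection crosses a single hyperplane, which belongs to the pair [k], [k + 1]. For
    [k != 0] these two indices have adjacent positions, so no other index changes its order with
    them. For [k = 0] they have the last and the first position, and the translation part
    compensates the jump. *)
Lemma signed_inv_simple_out k i j : i != k -> i != k + 1 -> signed_inv (simple k) i j = 0.
Proof.
move=> ik ik'; rewrite /signed_inv /= (@tpermD _ k (k + 1) i) 1?[k == _]eq_sym 1?[k + 1 == _]eq_sym //.
have posP p q : p != q -> pos p <> pos q by move=> /eqP pq /pos_inj.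
have [pik pik'] := (posP _ _ ik, posP _ _ ik').
have bound p : (pos p < n)%N by apply: ltn_ord.
have ps : k != 0 -> pos (k + 1) = (pos k).+1.
  by move=> k0; rewrite pos_succ posE (negPf k0) prednK // lt0n.
have [k0|k0] := eqVneq k 0; last first.
  rewrite !cwcoord0 subrr sub0r addrC; apply/eqP; rewrite subr_eq0; apply/eqP.
  congr (nat_of_bool _)%:R; have := ps k0.
  case: tpermP => [->|->|/eqP jk /eqP jk'] //=; lia.
have p0 : pos k = m.+1 by rewrite posE k0.
have p1 : pos (k + 1) = 0%N by rewrite k0 posE /=.
have bi := bound i.
have k1 : k + 1 = 1 by rewrite k0 add0r.
have -> : eps 1 - eps 0 = eps (k + 1) - eps k :> coweight m by rewrite k1 k0.
rewrite !cwcoordD !cwcoordN !cwcoord_eps.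
case: tpermP => [->|->|/eqP jk /eqP jk'].
- rewrite p1 p0 !eqxx (negPf ik) (negPf ik') (negPf (succ_neq k)).
  have -> : (0 < pos i)%N by lia.
  have -> : (m.+1 < pos i)%N = false by lia.
  by rewrite mulr1n mulr0n; ring.
- rewrite p1 p0 !eqxx (eq_sym k (k + 1)) (negPf ik) (negPf ik') (negPf (succ_neq k)).
  have -> : (0 < pos i)%N by lia.
  have -> : (m.+1 < pos i)%N = false by lia.
  by rewrite mulr1n mulr0n; ring.
by rewrite (negPf jk) (negPf jk') (negPf ik) (negPf ik') mulr0n; ring.
Qed.

Lemma signed_inv_simple k : signed_inv (simple k) k (k + 1) = -1.
Proof.
rewrite /signed_inv /= tpermL tpermR.
have [k0|k0] := eqVneq k 0.
  have -> : eps 1 - eps 0 = eps (k + 1) - eps k :> coweight m by rewrite k0 add0r.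
  rewrite !cwcoordD !cwcoordN !cwcoord_eps !eqxx (negPf (succ_neq k)) (eq_sym k) (negPf (succ_neq k)).
  by rewrite pos_succ posE k0 /= mulr1n mulr0n; ring.
rewrite !cwcoord0 subrr sub0r pos_succ posE (negPf k0).
have k1 : (0 < k)%N by rewrite lt0n.
have -> : (k.-1 < k)%N by lia.
have -> : (k < k.-1)%N = false by lia.
by rewrite addr0.
Qed.
End AffineLength.

(** * Words in the simple reflections and the element [tau] *)

Section ExtendedWords.
Variable m : nat.
Local Notation n := m.+2.
Local Notation W := (extW m).
Implicit Types (x y : W) (i j k : 'I_n) (l : nat).

Lemma word_nil : word [::] = 1%g :> W.
Proof. exact: big_nil. Qed.

Lemma word_cons i s : word (i :: s) = (simple i * word s)%g.
Proof. exact: big_cons. Qed.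

Lemma word_rcons i s : word (rcons s i) = (word s * simple i)%g.
Proof. by rewrite /word -cats1 big_cat big_seq1. Qed.

Lemma ext_tr_word s : (0 : 'I_n) \notin s -> ext_tr (word s) = 0.
Proof.
elim: s => [|i s IHs]; first by rewrite word_nil.
rewrite inE negb_or word_cons ext_trM eq_sym => /andP[/negPf i0 /IHs ->].
by rewrite raddf0 addr0 /= i0.
Qed.

Lemma val_natr l : (l < n)%N -> (l%:R : 'I_n) = l :> nat.
Proof. by move=> ln; rewrite Zp_nat /= modn_small. Qed.

Lemma natr_val i : (nat_of_ord i)%:R = i.
Proof. by apply: val_inj; rewrite /= val_natr. Qed.

Lemma natr_neq0 l : (0 < l < n)%N -> (l%:R : 'I_n) != 0.
Proof. by case/andP=> l0 ln; rewrite -val_eqE /= val_natr // -lt0n. Qed.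

(** The product of the first [l] finite reflections is the cycle on 1, ..., l+1. For [l = n - 1] the
    index [l.+1%:R] is 0, the representative of n. *)
Lemma cox_partial l i : (l <= m.+1)%N ->
  ext_perm (word [seq (t%:R : 'I_n) | t <- iota 1 l]) i
  = if (0 < i <= l)%N then i + 1 else if i == l.+1%:R then 1 else i.
Proof.
elim: l i => [|l IHl] i lm.
  rewrite word_nil perm1; have -> : (0 < i <= 0)%N = false by lia.
  by case: eqP => // ->.
have -> : iota 1 l.+1 = rcons (iota 1 l) l.+1 by rewrite -{1}[l.+1]addn1 iotaD cats1 add1n.
rewrite map_rcons word_rcons ext_permM IHl; last exact: ltnW.
have l2 : (0 < (l.+2%:R : 'I_n) <= l.+1)%N = false.
  rewrite Zp_nat /=; have [h|h] := ltnP l.+2 n; first by rewrite modn_small //; lia.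
  by rewrite (_ : l.+2 = n) ?modnn //; lia.
have l2' : (0 < (l.+2%:R : 'I_n) <= l)%N = false by lia.
have ll : (l.+2%:R == l.+1%:R :> 'I_n) = false.
  by rewrite -[l.+2%:R]natr1; apply/negbTE; exact: succ_neq.
have lv : (l.+1%:R : 'I_n) = l.+1 :> nat by apply: val_natr.
rewrite ext_permS [l.+1%:R + 1]natr1; case: tpermP => [->|->|/eqP il /eqP il'].
- by rewrite l2' ll lv leqnn andbT ltn0Sn natr1.
- by rewrite l2 !eqxx lv ltnn andbF.
have -> : (0 < i <= l.+1)%N = (0 < i <= l)%N.
  have : i <> l.+1 :> nat by rewrite -lv => /val_inj /eqP; rewrite (negPf il).
  lia.
by rewrite (negPf il) (negPf il').
Qed.

Lemma ext_perm_tau i : ext_perm (tau m) i = i + 1.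
Proof.
rewrite /tau ext_permM perm1 /cox cox_partial //.
have [i0|i0] := eqVneq i 0.
  rewrite i0 /= add0r (_ : n%:R = 0) ?eqxx //.
  by apply: val_inj; rewrite Zp_nat /= modnn.
by rewrite lt0n i0 -ltnS ltn_ord.
Qed.

Lemma omega1 : omega 1 = eps 1 :> coweight m.
Proof.
rewrite omega_eps (bigD1 1) //= big1 ?addr0 // => i /andP[i1 /negP[]].
have v1 : (1 : 'I_n) = 1%N :> nat by rewrite -[RHS](@modn_small _ n).
by apply/eqP/val_inj => /=; move: i1; case: i => [[|[|]]].
Qed.

Lemma ext_tr_tau : ext_tr (tau m) = eps 1.
Proof.
rewrite /tau ext_trM ext_tr_word ?raddf0 ?addr0 -?omega1 //.
apply/mapP => -[t]; rewrite mem_iota => t1 /eqP; rewrite eq_sym; apply/negP.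
exact: natr_neq0.
Qed.

(** [tau] preserves the fundamental alcove. Index 0, which has the last position, moves to the first
    position, and the translation [eps 1] makes up for that change of order. *)
Lemma signed_inv_tau i j : signed_inv (tau m) i j = 0.
Proof.
rewrite /signed_inv ext_tr_tau !ext_perm_tau !pos_succ !cwcoord_eps !posE.
have e k : (k + 1 == 1) = (k == 0) by rewrite -subr_eq0 addrK.
rewrite !e.
have bnd k : (k.-1 < m.+1)%N /\ (m.+1 < k.-1)%N = false.
  by have := ltn_ord k; lia.
have [->|i0] := eqVneq i 0; have [->|j0] := eqVneq j 0.
- by rewrite !ltnn mulr0n; ring.
- by rewrite ltn0 (bnd j).1 mulr0n mulr1n; ring.
- by rewrite lt0n i0 (bnd i).2 mulr0n mulr1n; ring.
have -> : (j.-1 < i.-1)%N = (j < i)%N.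
  have : (0 < i)%N /\ (0 < j)%N by rewrite !lt0n; split.
  lia.
by rewrite mulr0n; ring.
Qed.

Lemma extW_ext x y :
  ext_tr x = ext_tr y -> (forall i, ext_perm x i = ext_perm y i) -> x = y.
Proof. by case: x y => [u s] [v t] /= -> /permP ->. Qed.

Lemma ext_tr_simple i :
  ext_tr (simple i) = if i == 0 then eps 1 - eps 0 else 0.
Proof. by []. Qed.

Lemma tau_simple i : (tau m * simple i)%g = (simple (i + 1) * tau m)%g.
Proof.
apply: extW_ext => [|k]; last first.
  rewrite (ext_permM (tau m)) (ext_permM (simple _)) !ext_perm_tau !ext_permS.
  have [->|ki] := eqVneq k i; first by rewrite !tpermL.
  have [->|ki'] := eqVneq k (i + 1); first by rewrite !tpermR.
  by rewrite !tpermD // 1?eq_sym // (inj_eq (@addIr _ 1)) // eq_sym.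
rewrite (ext_trM (tau m)) (ext_trM (simple _)) ext_tr_tau !ext_tr_simple perm_eps ext_permS.
have [->|i0] := eqVneq i 0.
  rewrite !add0r; move: (ext_perm_tau 1) (ext_perm_tau 0); move: (ext_perm _) => p p1 p0.
  by rewrite raddfB /= !perm_eps p1 p0 tpermL add0r addrC subrK.
rewrite raddf0 addr0; have [i1|i1] := eqVneq (i + 1) 0.
  by rewrite i1 add0r tpermR subrK.
have s1 : i + 1 != 1 by rewrite -subr_eq0 addrK.
by rewrite add0r tpermD // -subr_eq0 addrK.
Qed.
End ExtendedWords.

(** * Descents, lengths and minimal coset representatives *)

Section Length.
Variable m : nat.
Local Notation n := m.+2.
Local Notation W := (extW m).
Implicit Types (x y : W) (i j k : 'I_n) (s : seq 'I_n).

Lemma pos_succS k : k != 0 -> pos (k + 1) = (pos k).+1.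
Proof. by move=> k0; rewrite pos_succ posE (negPf k0) prednK // lt0n. Qed.

Lemma pos0 : pos (0 : 'I_n) = m.+1.
Proof. by rewrite posE. Qed.

Lemma pos1 : pos (1 : 'I_n) = 0%N.
Proof. by rewrite /pos subrr. Qed.

Lemma pos_lt k : (pos k < n)%N.
Proof. exact: ltn_ord. Qed.

Lemma ext_perm1 i : ext_perm (1 : W)%g i = i.
Proof. exact: perm1. Qed.

Lemma ext_perm_tauX r i : ext_perm (tau m ^+ r)%g i = i + r%:R.
Proof.
elim: r => [|r IHr]; first by rewrite expg0 ext_perm1 addr0.
by rewrite expgS (ext_permM (tau m)) IHr ext_perm_tau -addrA natr1.
Qed.

Lemma ext_tr_tauX r : ext_tr (tau m ^+ r)%g = \sum_(1 <= t < r.+1) eps t%:R.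
Proof.
elim: r => [|r IHr]; first by rewrite expg0 big_geq.
rewrite expgS (ext_trM (tau m)) IHr ext_tr_tau [RHS]big_nat_recl //; congr (_ + _).
have := @ext_perm_tau m; move: (ext_perm (tau m)) => p pE.
by rewrite raddf_sum; apply: eq_bigr => t _; rewrite /= perm_eps pE natr1.
Qed.

Lemma sum_eps : \sum_i eps i = 0 :> coweight m.
Proof.
apply: cwcoord_inj => i; rewrite cwcoord_sum cwcoord0.
under eq_bigr do rewrite cwcoord_eps.
rewrite sumrB sumr_const card_ord -[X in _ - X]mulr_natl divff ?pnatr_eq0 //.
by rewrite (bigD1 i) //= eqxx big1 ?addr0 ?subrr // => k; rewrite eq_sym => /negPf ->.
Qed.

(** The translation part is the sum of all [eps i], which vanishes. *)
Lemma tauXn : (tau m ^+ n)%g = 1%g.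
Proof.
have n0 : n%:R = 0 :> 'I_n by apply: val_inj; rewrite Zp_nat /= modnn.
apply: extW_ext => [|i]; last by rewrite ext_perm_tauX ext_perm1 n0 addr0.
rewrite ext_tr_tauX big_add1 big_mkord -[RHS]sum_eps.
rewrite [RHS](reindex_inj (@addIr _ 1)) /=; apply: eq_bigr => i _.
by rewrite -natr1 natr_val.
Qed.

Lemma signed_inv_tauX r i j : signed_inv (tau m ^+ r)%g i j = 0.
Proof.
elim: r i j => [|r IHr] i j.
  by rewrite expg0 /signed_inv !ext_perm1 !cwcoord0 subrr sub0r addrC subrr.
by rewrite expgS (signed_invM (tau m)) IHr signed_inv_tau addr0.
Qed.

Lemma signed_inv_tauXM r x i j : signed_inv (tau m ^+ r * x)%g i j = signed_inv x i j.
Proof. by rewrite signed_invM signed_inv_tauX add0r. Qed.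

(* Twice the length: each unordered pair is counted in both orders. *)
Definition double_len x : rat := \sum_(p : 'I_n * 'I_n) `|signed_inv x p.1 p.2|.

Lemma double_len_ge0 x : 0 <= double_len x.
Proof. by apply: sumr_ge0. Qed.

Lemma signed_inv_diag x i : signed_inv x i i = 0.
Proof. by have := signed_inv_sym x i i; lra. Qed.

Lemma double_lenM x y : double_len (x * y)%g =
  \sum_(p : 'I_n * 'I_n) `|signed_inv x p.1 p.2 +
    signed_inv y ((ext_perm y)^-1%g p.1) ((ext_perm y)^-1%g p.2)|.
Proof.
pose f (p : 'I_n * 'I_n) := ((ext_perm y)^-1%g p.1, (ext_perm y)^-1%g p.2).
have f_inj : injective f by move=> [a b] [c d] [/perm_inj -> /perm_inj ->].
by rewrite /double_len (reindex_inj f_inj); apply: eq_bigr => p _; rewrite signed_invM !permKV.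
Qed.

Definition descent x k := signed_inv x k (k + 1) < 0.

(** Right multiplication by [simple k] permutes the index pairs and alters [signed_inv] only at the
    pair [k], [k + 1], by one. The sign of the old value decides whether the absolute value drops or
    grows; the two orders of the pair make the change 2. *)
Lemma double_len_simple x k :
  double_len (x * simple k)%g = double_len x + (if descent x k then -2 else 2).
Proof.
rewrite double_lenM; set g := signed_inv x k (k + 1).
have k1k := negPf (succ_neq k).
have kk1 : (k == k + 1) = false by rewrite eq_sym.
rewrite /double_len (bigD1 (k, k + 1)) //= (bigD1 (k + 1, k)) /=; last by rewrite xpair_eqE k1k.
rewrite [in RHS](bigD1 (k, k + 1)) //= [in RHS](bigD1 (k + 1, k)) /=; last by rewrite xpair_eqE k1k.
rewrite tpermV tpermL tpermR (signed_inv_sym (simple k) k) (signed_inv_sym x k) signed_inv_simple opprK -/g.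
rewrite -opprD normrN (normrN g).
rewrite (eq_bigr (fun p => `|signed_inv x p.1 p.2|)) => [|[i j] /= ij].
  rewrite /descent -/g; case: ltP => g0.
    have g1 : g <= -1 by apply: signed_inv_lt0.
    rewrite !ler0_norm; lra.
  by rewrite !ger0_norm; lra.
have [->|ij'] := eqVneq i j; first by rewrite !signed_inv_diag addr0.
move: ij; rewrite !xpair_eqE => /andP[ij1 ij2].
have out a b : a != k -> a != k + 1 ->
    signed_inv (simple k) (tperm k (k + 1) a) (tperm k (k + 1) b) = 0.
  move=> ak ak'; rewrite (tpermD (z := a)) 1?[k == a]eq_sym 1?[k + 1 == a]eq_sym //.
  exact: signed_inv_simple_out.
have [ik|ik] := eqVneq i k.
  rewrite ik eqxx /= in ij1; rewrite ik eq_sym in ij'.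
  by rewrite (signed_inv_sym (simple k)) out // oppr0 addr0.
have [ik'|ik'] := eqVneq i (k + 1).
  rewrite ik' eqxx /= in ij2; rewrite ik' eq_sym in ij'.
  by rewrite (signed_inv_sym (simple k)) out // oppr0 addr0.
by rewrite out // addr0.
Qed.

(** Induction on the position gives [pos i <= pos (v i)]. Both sides have the same sum over all [i],
    so equality holds everywhere. *)
Lemma perm_pos_mono (v : 'S_n) :
  (forall i j, (pos i < pos j)%N -> (pos (v i) < pos (v j))%N) -> v = 1%g.
Proof.
move=> mono; have le l i : (pos i = l -> l <= pos (v i))%N.
  elim: l i => // l IHl i il.
  have i0 : i - 1 != 0.
    apply/eqP => e; move: il; rewrite -(subrK 1 i) e add0r pos1; lia.
  have il' : pos (i - 1) = l by move: il; rewrite -{1}(subrK 1 i) pos_succS // => -[].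
  apply: (leq_ltn_trans (IHl _ il')); apply: mono; lia.
have le' i : (pos i <= pos (v i) ?= iff (pos i == pos (v i)))%N.
  by apply/leqif_eq/le.
have eS : (\sum_(i : 'I_n) pos i = \sum_i pos (v i))%N by rewrite (reindex_inj (@perm_inj _ v)).
have [_] := leqif_sum (P := xpredT) (fun i _ => le' i).
rewrite eS eqxx => /esym/forallP /= e; apply/permP => i; rewrite perm1.
by apply/pos_inj/eqP; rewrite eq_sym.
Qed.

(** For positions in increasing order, [signed_inv x] is superadditive along [i], [j - 1], [j],
    since an inversion of the outer pair forces one of an inner pair. Induction on the position of
    [j] then reduces to adjacent pairs. *)
Lemma fin_no_descent x : (forall k, k != 0 -> ~~ descent x k) ->
  forall i j, (pos i < pos j)%N -> 0 <= signed_inv x i j.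
Proof.
move=> nd i j; move: {-2}(pos j) (erefl (pos j)) => l; elim: l j => // l IHl j jl il.
have j0 : j - 1 != 0.
  apply/eqP => e; move: jl; rewrite -(subrK 1 j) e add0r pos1; lia.
have jl' : pos (j - 1)%R = l by move: jl; rewrite -{1}(subrK 1 j) pos_succS // => -[].
have := nd _ j0; rewrite /descent -leNgt subrK => g1.
have [e|ne] := eqVneq i (j - 1); first by rewrite e.
have ij : (pos i < pos (j - 1)%R)%N.
  by rewrite jl' ltn_neqAle -ltnS il -jl' (inj_eq (@pos_inj _)) ne.
have := IHl _ (esym jl'); rewrite -jl' => /(_ ij); move: g1; rewrite /signed_inv.
have -> : (pos (j - 1)%R < pos i)%N = false by lia.
have -> : (pos j < pos i)%N = false by lia.
have -> : (pos j < pos (j - 1)%R)%N = false by lia.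
move: (ext_perm x j) (ext_perm x i) (ext_perm x (j - 1)) => a b c.
have : ((pos a < pos b)%N <= (pos c < pos b)%N + (pos a < pos c)%N)%N by lia.
rewrite -(ler_nat rat) natrD mulr0n !addr0 => *; lra.
Qed.

(** Among the translation coordinates at the images, the one of index 1 is least and the one of
    index 0 is greatest, by the finite non-descents. The non-descent at 0 gives the reverse
    inequality between these two. All coordinates are thus equal, hence zero because their sum is,
    and the permutation is increasing. *)
Lemma no_descent_fix1 x : (forall k, ~~ descent x k) -> ext_perm x 1 = 1 -> x = 1%g.
Proof.
move=> nd v1; have ge0 := fin_no_descent (fun k _ => nd k).
have v0 : (0 < pos (ext_perm x 0%R))%N.
  rewrite lt0n -pos1 (inj_eq (@pos_inj _)) -v1 (inj_eq perm_inj).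
  by rewrite eq_sym oner_eq0.
have ge1 i : cwcoord (ext_tr x) 1 <= cwcoord (ext_tr x) (ext_perm x i).
  have [->|i1] := eqVneq i 1; first by rewrite v1.
  have : (pos (1%R : 'I_n) < pos i)%N by rewrite pos1 lt0n -pos1 (inj_eq (@pos_inj _)).
  by move/ge0; rewrite /signed_inv v1 !pos1 !ltn0 mulr0n; lra.
have le0 i : cwcoord (ext_tr x) (ext_perm x i) <= cwcoord (ext_tr x) (ext_perm x 0).
  have [-> //|i0] := eqVneq i 0.
  have : (pos i < pos (0%R : 'I_n))%N.
    rewrite pos0 ltn_neqAle -ltnS pos_lt andbT -pos0 (inj_eq (@pos_inj _)) //.
  move=> i0'; have := ge0 _ _ i0'; rewrite /signed_inv [(pos 0%R < pos i)%N]ltnNge (ltnW i0') mulr0n.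
  have : 0 <= (pos (ext_perm x 0%R) < pos (ext_perm x i))%N%:R :> rat by [].
  by lra.
have cst i : cwcoord (ext_tr x) (ext_perm x i) = cwcoord (ext_tr x) 1.
  apply/eqP; rewrite eq_le ge1 andbT; apply: (le_trans (le0 i)).
  by have := nd 0; rewrite /descent -leNgt add0r /signed_inv v1 pos1 v0 pos0 mulr1n /=; lra.
have tr0 : ext_tr x = 0.
  apply: cwcoord_inj => i; rewrite cwcoord0.
  have := cwcoord_sum0 (ext_tr x).
  rewrite (reindex_inj (@perm_inj _ (ext_perm x))) /=.
  under eq_bigr do rewrite cst.
  rewrite sumr_const card_ord => /eqP; rewrite mulrn_eq0 /= => /eqP c0.
  by rewrite -(permKV (ext_perm x) i) cst.
apply: extW_ext => // i; rewrite ext_perm1.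
rewrite (@perm_pos_mono (ext_perm x)) ?perm1 // => {}i j ij.
have := ge0 _ _ ij; rewrite /signed_inv tr0 !cwcoord0 [(pos j < _)%N]ltnNge (ltnW ij) mulr0n.
have ne : ext_perm x i != ext_perm x j.
  by apply: contraTneq ij => /perm_inj ->; rewrite ltnn.
by move: ne; rewrite -(inj_eq (@pos_inj _)); case: ltngtP => //= _ _; lra.
Qed.

Lemma no_descent x : (forall k, ~~ descent x k) -> exists r, x = (tau m ^+ r)%g.
Proof.
(* The power of [tau] that brings the image of 1 back to 1; left multiplication by it leaves
   [signed_inv] unchanged. *)
move=> nd; pose r := nat_of_ord (1 - ext_perm x 1)%R.
have y1 : (tau m ^+ r * x)%g = 1%g.
  apply: no_descent_fix1 => [k|]; first by rewrite /descent signed_inv_tauXM; apply: nd.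
  by rewrite ext_permM ext_perm_tauX natr_val addrC subrK.
exists (n - r)%N; apply: (mulgI (tau m ^+ r)%g).
rewrite y1 -expgD subnKC ?tauXn //; exact/ltnW/ltn_ord.
Qed.

Lemma double_len_tauX r : double_len (tau m ^+ r)%g = 0.
Proof. by rewrite /double_len big1 // => p _; rewrite signed_inv_tauX normr0. Qed.

(** Descents are stripped off one at a time, each lowering [double_len] by 2; an element without
    descents is a power of [tau]. *)
Lemma exists_dec x : exists d, is_dec x d /\ double_len x = (size d.2)%:R *+ 2.
Proof.
(* [double_len] is rational-valued, so a natural upper bound serves as the induction measure. *)
have [l] : exists l : nat, double_len x < l%:R.
  by exists (Num.bound (double_len x)); apply/archi_boundP/double_len_ge0.
elim: l x => [|l IHl] x xl; first by have := double_len_ge0 x; rewrite leNgt xl.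
have [/existsP[k kd]|] := boolP [exists k, descent x k].
  have iE := double_len_simple x k; rewrite kd in iE.
  have [|[r s] [/= dE sE]] := IHl (x * simple k)%g.
    by rewrite iE; move: xl; rewrite -natr1; lra.
  exists (r, rcons s k); split; last by rewrite /= size_rcons -natr1; move: sE; rewrite iE mulr2n; lra.
  by rewrite /is_dec /= word_rcons mulgA -dE -mulgA simple2 mulg1.
rewrite negb_exists => /forallP /no_descent [r xE].
by exists (r, [::]); rewrite /is_dec /= word_nil mulg1; split; rewrite // xE double_len_tauX.
Qed.

Lemma double_len_le_dec x d : is_dec x d -> double_len x <= (size d.2)%:R *+ 2.
Proof.
case: d => r s; rewrite /is_dec /= => -> {x}.
elim/last_ind: s => [|s k IHs]; first by rewrite word_nil mulg1 double_len_tauX.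
rewrite word_rcons mulgA double_len_simple size_rcons -natr1; move: IHs.
by rewrite !mulr2n; case: ifP => _; lra.
Qed.

(** This excludes the default value in [reduced_dec] and identifies [ell] with half of
    [double_len]. *)
Lemma reduced_decP x : is_dec x (reduced_dec x) /\ double_len x = (ell x)%:R *+ 2.
Proof.
have [d [dE xE]] := exists_dec x.
rewrite /ell /reduced_dec; case: pselect => [e|[]].
  case: (cid e) => /= d' [dE' min]; split=> //.
  apply/le_anti; rewrite double_len_le_dec //= xE lerMn2r /= ler_nat; exact: min.
exists d; split=> // d' /double_len_le_dec.
by rewrite xE lerMn2r /= ler_nat.
Qed.

(** For each pair the contributions of [x] and of the finite factor have the same sign, so absolute
    values add up. A nontrivial permutation inverts some pair, where the growth is strict. *)
Lemma fin_no_descent_minW x : (forall k, k != 0 -> ~~ descent x k) -> minW x.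
Proof.
move=> nd v v1; rewrite -(ltr_nat rat) -(ltr_pMn2r (ltn0Sn 1)).
rewrite -(reduced_decP _).2 -(reduced_decP _).2 double_lenM /=.
set u := v^-1%g; have ge0 := fin_no_descent nd.
have gE i j : signed_inv (ExtW 0 v) (u i) (u j)
    = (pos (u j) < pos (u i))%N%:R - (pos j < pos i)%N%:R.
  by rewrite /signed_inv /= !permKV !cwcoord0; lra.
have [i [j [ij uij]]] : exists i j, (pos i < pos j)%N /\ (pos (u j) < pos (u i))%N.
  have [/existsP[i /existsP[j /andP[ij uij]]]|] :=
    boolP [exists i, exists j, (pos i < pos j)%N && (pos (u j) < pos (u i))%N].
    by exists i, j.
  rewrite negb_exists => /forallP ne; case/eqP: v1; apply/invg_inj; rewrite invg1.
  apply: perm_pos_mono => i j ij; have := ne i; rewrite negb_exists => /forallP/(_ j).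
  rewrite ij -leqNgt leq_eqVlt (inj_eq (@pos_inj _)) (inj_eq perm_inj) => /orP[/eqP ij'|//].
  by rewrite ij' ltnn in ij.
rewrite /double_len (bigD1 (i, j)) // [ltRHS](bigD1 (i, j)) //=; apply: ltr_leD => [|].
  rewrite gE uij ltnNge (ltnW ij) mulr1n mulr0n; have := ge0 _ _ ij => g.
  by rewrite !ger0_norm; lra.
apply: ler_sum => -[k l] _ /=; rewrite gE; case: (ltngtP (pos k) (pos l)) => kl.
- have := ge0 _ _ kl; have : 0 <= (pos (u l) < pos (u k))%N%:R :> rat by [].
  by rewrite mulr0n => ? ?; rewrite !ger0_norm; lra.
- have := ge0 _ _ kl; rewrite signed_inv_sym.
  have : (pos (u l) < pos (u k))%N%:R <= 1 :> rat by case: (_ < _)%N.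
  by rewrite mulr1n => ? ?; rewrite !ler0_norm; lra.
by rewrite (pos_inj kl) ltnn mulr0n subrr addr0.
Qed.

End Length.

(** * Braid relations and Matsumoto's theorem *)

Lemma conj_braid (G : groupType) (t x y : G) :
  (x * y * x = y * x * y -> x ^ t * y ^ t * x ^ t = y ^ t * x ^ t * y ^ t)%g.
Proof. by rewrite -!conjMg => ->. Qed.

Lemma conj_comm (G : groupType) (t x y : G) :
  (x * y = y * x -> x ^ t * y ^ t = y ^ t * x ^ t)%g.
Proof. by rewrite -!conjMg => ->. Qed.

Section Braid.
Variable m : nat.
Local Notation n := m.+2.
Local Notation W := (extW m).
Implicit Types (x y : W) (i j k : 'I_n).

Lemma tauX_simple r i :
  (tau m ^+ r * simple i)%g = (simple (i + r%:R) * tau m ^+ r)%g.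
Proof.
elim: r i => [|r IHr] i; first by rewrite expg0 mul1g mulg1 addr0.
by rewrite expgS -mulgA IHr mulgA tau_simple -mulgA -addrA natr1.
Qed.

(** Away from index 0 there are no translation parts, and the relation is one between
    transpositions. *)
Lemma simple_braid1 i : i != 0 -> i + 1 != 0 -> i != i + 1 + 1 ->
  (simple i * simple (i + 1) * simple i
   = simple (i + 1) * simple i * simple (i + 1))%g.
Proof.
move=> i0 i1 ii2; apply: extW_ext => [|k].
  by rewrite !ext_trM !ext_tr_simple (negPf i0) (negPf i1) !raddf0 !addr0.
rewrite !ext_permM !ext_permS -!permM; congr (fun_of_perm _ _); rewrite -?mulgA.
have J (p q : 'S_n) : (p * p = 1)%g -> (p * (q * p) = q ^ p)%g.
  move=> pp; have /eqP pV : p^-1%g == p by rewrite eq_invg_mul pp.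
  by rewrite conjgE pV.
rewrite (J (tperm i _)) ?tperm2 // (J (tperm (i + 1) _)) ?tperm2 // !tpermJ.
by rewrite !tpermL !tpermR !tpermD //; rewrite ?succ_neq // eq_sym ?succ_neq.
Qed.

Lemma simple_shift i r : simple (i + r%:R) = (simple i ^ (tau m ^+ r)^-1)%g.
Proof. by rewrite conjgE invgK mulgA tauX_simple mulgK. Qed.

Lemma index_shift1 i : exists r, i = 1 + r%:R.
Proof. by exists (nat_of_ord (i - 1)%R); rewrite natr_val addrC subrK. Qed.

(** Conjugation by a power of [tau] reduces to [i = 1]. The hypothesis excludes n = 2, and for n > 2
    neither 1 nor 2 is zero modulo n. *)
Lemma simple_braid i : i != i + 1 + 1 ->
  (simple i * simple (i + 1) * simple i
   = simple (i + 1) * simple i * simple (i + 1))%g.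
Proof.
have [r ->] := index_shift1 i; rewrite ![_ + r%:R + 1]addrAC.
rewrite (inj_eq (@addIr _ r%:R)) => ii2; rewrite !simple_shift.
apply: conj_braid; apply: simple_braid1; rewrite ?oner_eq0 //.
by move: ii2; rewrite eq_sym -subr_eq0 addrK.
Qed.

Lemma simple_comm i j : i != j -> i != j + 1 -> j != i + 1 ->
  (simple i * simple j = simple j * simple i)%g.
Proof.
have [r ->] := index_shift1 i; rewrite -(subrK r%:R j) ![_ + r%:R + 1]addrAC.
move: (j - r%:R) => {}j; rewrite !(inj_eq (@addIr _ r%:R)) => ij ij' ji'; rewrite !simple_shift.
apply: conj_comm; apply: extW_ext => [|k].
  have j0 : j != 0 by apply: contraNneq ij' => ->; rewrite add0r.
  by rewrite !ext_trM !ext_tr_simple oner_eq0 (negPf j0) !raddf0 !addr0.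
rewrite !ext_permM !ext_permS -!permM; congr (fun_of_perm _ _).
by rewrite conjgC tpermJ !tpermD // 1?eq_sym // (inj_eq (@addIr _ 1)) // eq_sym.
Qed.

End Braid.

(** * Relations in the nilHecke algebra *)

Lemma braid_module_eq (F : fieldType) (V : lmodType F) (c d : F) (x y z t u e : V) :
  c *: x - c *: y - ((- d) *: e - (- d) *: t) - (c *: z - c *: u - ((c + d) *: t - (c + d) *: e))
  = c *: x + c *: - y + c *: - z + c *: t + c *: u - c *: e.
Proof.
rewrite !scalerDl !scaleNr !scalerN.
move: (c *: x) (c *: y) (c *: z) (c *: t) (c *: u) (c *: e) (d *: t) (d *: e).
move=> {}x {}y {}z {}t {}u {}e t' e'.
rewrite !opprB !opprD !opprK !addrA.
by rewrite [LHS](ACl (1*2*10*5*9*7*3*6*4*8)) /= subrK addrK.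
Qed.

Section TwistedDivDiff.
Variables (F : fieldType) (W : groupType) (act : W -> {rmorphism F -> F}).
Variables (tw : lalgType F) (g : W -> tw).
Hypothesis gM : forall v w, g v * g w = g (v * w)%g.
Hypothesis g1 : g 1%g = 1.
Hypothesis gZ : forall w p x, g w * (p *: x) = act w p *: (g w * x).
Implicit Types (v w : W) (a b p : F) (x : tw).

Definition twdiff w a : tw := a^-1 *: (g w - 1).

Lemma twdiffM w a x : twdiff w a * x = a^-1 *: (g w * x - x).
Proof. by rewrite /twdiff -scalerAl mulrBl mul1r. Qed.

Lemma g_twdiff v w b : g v * twdiff w b =
  (act v b)^-1 *: (g (v * w)%g - g v).
Proof. by rewrite gZ mulrBr mulr1 gM fmorphV. Qed.

Lemma twdiff_conj v w u a : (v * w = u * v)%g ->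
  g v * twdiff w a = twdiff u (act v a) * g v.
Proof.
by move=> vw; rewrite g_twdiff vw /twdiff -scalerAl mulrBl mul1r gM.
Qed.

Lemma twdiff_sqr w a : (w * w = 1)%g -> act w a = - a ->
  twdiff w a * twdiff w a = 0.
Proof.
move=> ww wa; rewrite twdiffM g_twdiff wa ww g1 invrN scaleNr /twdiff.
by rewrite -scalerN opprB subrr scaler0.
Qed.

Lemma twdiff_comm v w a b : (v * w = w * v)%g ->
  act v b = b -> act w a = a ->
  twdiff v a * twdiff w b = twdiff w b * twdiff v a.
Proof.
move=> vw vb wa; rewrite !twdiffM !g_twdiff vb wa vw /twdiff -!scalerBr !scalerA.
rewrite [b^-1 * _]mulrC; congr (_ *: _).
by rewrite !opprB !addrA addrAC [in RHS]addrAC; congr (_ + _); rewrite addrAC.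
Qed.

(** Except for the term [v * w * v], the expanded form is symmetric under exchange of [(v, a)] with
    [(w, b)]. The braid relation of the operators thus follows from the one in the group. *)
Lemma twdiff_braid_expand v w a b :
  a != 0 -> b != 0 -> a + b != 0 -> (v * v = 1)%g ->
  act v a = - a -> act v b = a + b -> act w a = a + b ->
  twdiff v a * twdiff w b * twdiff v a =
  (a * b * (a + b))^-1 *: (g (v * w * v)%g - g (v * w)%g
    - g (w * v)%g + g v + g w - 1).
Proof.
move=> a0 b0 ab0 vv va vb wa; rewrite -mulrA !twdiffM !g_twdiff wa.
rewrite /twdiff !(scalerBr, scalerA, mulrBr, gZ, gM).
rewrite !fmorphV rmorphD va vb addKr vv !mulr1 mulgA g1 !scalerDr.
set c := (a * b * (a + b))^-1; set d := (a * a * (a + b))^-1.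
have -> : a^-1 / (a + b) / b = c by rewrite /c; field; rewrite ?a0 ?b0 ?ab0.
have -> : a^-1 / (a + b) / (- a) = - d by rewrite /d; field; rewrite ?oppr_eq0 ?a0 ?ab0.
have -> : a^-1 / b / (a + b) = c by rewrite /c; field; rewrite ?a0 ?b0 ?ab0.
have -> : a^-1 / b / a = c + d by rewrite /c /d; field; rewrite ?a0 ?b0 ?ab0.
exact: braid_module_eq.
Qed.

Lemma twdiff_braid v w a b :
  a != 0 -> b != 0 -> a + b != 0 -> (v * v = 1)%g -> (w * w = 1)%g ->
  (v * w * v = w * v * w)%g ->
  act v a = - a -> act v b = a + b ->
  act w b = - b -> act w a = a + b ->
  twdiff v a * twdiff w b * twdiff v a = twdiff w b * twdiff v a * twdiff w b.
Proof.
move=> a0 b0 ab0 vv ww vwv va vb wb wa.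
rewrite (twdiff_braid_expand a0 b0) // (twdiff_braid_expand b0 a0) ?[b + a]addrC //.
rewrite [b * a]mulrC vwv; congr (_ *: (_ - _)).
by rewrite [LHS](ACl (1*3*2*5*4)).
Qed.

End TwistedDivDiff.

Section NilHeckeRelations.
Variables (K : fieldType) (m : nat).
Hypothesis char2 : (2 : K) != 0.
Local Notation n := m.+2.
Local Notation W := (extW m).
Local Notation tw := (twalg K m).
Local Notation act := (weyl_action K m).
Local Notation F := (fracS K m).
Local Notation T := (grp act (tau m)).
Implicit Types (x y : W) (i j k : 'I_n).

(** The images of two distinct variables are separated by the point with coordinates 1 at [i], -1 at
    [j] and 0 elsewhere. It lies on the hyperplane of sum zero, and 1 differs from -1 as 2 is
    nonzero. *)
Lemma a_inj : injective (@a_ K m).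
Proof.
move=> i j aij; apply: contra_eq aij => ij.
pose v (k : 'I_n) : K := (k == i)%:R - (k == j)%:R.
have v0 p : p = lin_sum K m -> meval v p = 0.
  move=> ->; rewrite rmorph_sum /=; under eq_bigr do rewrite mevalXU.
  rewrite /v sumrB (bigD1 i) //= [X in _ - X](bigD1 j) //= !eqxx.
  by rewrite !big1 ?addr0 ?subrr // => k /negPf ->.
apply/eqP => /eqP; rewrite -Quotient.idealrBE => /(gen_ideal_ker v0).
rewrite rmorphB /= !mevalXU /v !eqxx (eq_sym j) (negPf ij) subr0 sub0r opprK.
exact/eqP.
Qed.

Lemma grpZ (w : W) (p : F) (x : tw) :
  grp act w * (p *: x) = fa_act act w p *: (grp act w * x).
Proof. by rewrite -mulr_algl mulrA grp_scale scalerAl. Qed.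

Lemma alpha_neq0 i : (alpha K i)%:F != 0 :> F.
Proof.
by rewrite tofrac_eq0 subr_eq0 (inj_eq a_inj) eq_sym; apply: succ_neq.
Qed.

Lemma act_a (w : W) i : fa_act act w (a_ K i)%:F = (a_ K (ext_perm w i))%:F.
Proof. by rewrite [LHS]actF_frac actS_a. Qed.

Lemma act_alpha (w : W) i :
  fa_act act w (alpha K i)%:F = (a_ K (ext_perm w i))%:F - (a_ K (ext_perm w (i + 1)))%:F.
Proof. by rewrite /alpha tofracB rmorphB /= !act_a. Qed.

Lemma act_alpha_sym i : fa_act act (simple i) (alpha K i)%:F = - (alpha K i)%:F.
Proof. by rewrite act_alpha tpermL tpermR /alpha tofracB opprB. Qed.

Lemma A_simpleE i : A_simple K i = twdiff (grp act) (simple i) (alpha K i)%:F.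
Proof. by []. Qed.

Lemma tau_A_simple i : T * A_simple K i = A_simple K (i + 1) * T.
Proof.
have -> : A_simple K (i + 1) = twdiff (grp act) (simple (i + 1)) (fa_act act (tau m) (alpha K i)%:F).
  by rewrite act_alpha !ext_perm_tau A_simpleE /alpha tofracB.
exact: (twdiff_conj (@grpM _ _ act) grpZ _ (tau_simple i)).
Qed.

Lemma A_simple2 i : A_simple K i * A_simple K i = 0.
Proof. exact: (twdiff_sqr (@grpM _ _ act) erefl grpZ (simple2 i) (act_alpha_sym i)). Qed.

Lemma A_comm i j : i != j -> i != j + 1 -> j != i + 1 ->
  A_simple K i * A_simple K j = A_simple K j * A_simple K i.
Proof.
have fix_alpha k l : k != l -> k != l + 1 -> l != k + 1 ->
    fa_act act (simple k) (alpha K l)%:F = (alpha K l)%:F.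
  move=> kl kl' lk; rewrite act_alpha /alpha tofracB !tpermD // 1?eq_sym //.
  by rewrite (inj_eq (@addIr _ 1)) eq_sym.
move=> ij ij' ji; apply: (twdiff_comm (@grpM _ _ act) grpZ); first exact: simple_comm.
  exact: fix_alpha.
by apply: fix_alpha => //; rewrite eq_sym.
Qed.

Lemma A_braid i : i != i + 1 + 1 ->
  A_simple K i * A_simple K (i + 1) * A_simple K i
  = A_simple K (i + 1) * A_simple K i * A_simple K (i + 1).
Proof.
move=> i2.
have i01 : i != i + 1 by rewrite eq_sym succ_neq.
have i12 : i + 1 != i + 1 + 1 by rewrite eq_sym succ_neq.
have sum_neq0 : (alpha K i)%:F + (alpha K (i + 1))%:F != 0 :> F.
  by rewrite -tofracD tofrac_eq0 /alpha addrA subrK subr_eq0 (inj_eq a_inj).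
have actl : fa_act act (simple i) (alpha K (i + 1))%:F = (alpha K i)%:F + (alpha K (i + 1))%:F.
  by rewrite act_alpha tpermR tpermD // /alpha !tofracB addrA subrK.
have actr : fa_act act (simple (i + 1)) (alpha K i)%:F = (alpha K i)%:F + (alpha K (i + 1))%:F.
  rewrite act_alpha tpermL tpermD; rewrite 1?eq_sym // /alpha !tofracB addrA subrK //.
exact: (twdiff_braid (@grpM _ _ act) erefl grpZ (alpha_neq0 i) (alpha_neq0 _)
  sum_neq0 (simple2 _) (simple2 _) (simple_braid i2) (act_alpha_sym i) actl
  (act_alpha_sym _) actr).
Qed.
End NilHeckeRelations.

(** * Descents and independence of the reduced word *)

Section Descents.
Variable m : nat.
Local Notation n := m.+2.
Local Notation W := (extW m).
Implicit Types (x y : W) (i j k : 'I_n) (s : seq 'I_n).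

Lemma mulgKs x i : (x * simple i * simple i)%g = x.
Proof. by rewrite -mulgA simple2 mulg1. Qed.

Lemma signed_invMs x k i j : signed_inv (x * simple k)%g i j
  = signed_inv x (tperm k (k + 1) i) (tperm k (k + 1) j) + signed_inv (simple k) i j.
Proof. exact: signed_invM. Qed.

Lemma signed_inv_simple_outr k i j : j != k -> j != k + 1 -> signed_inv (simple k) i j = 0.
Proof. by move=> jk jk'; rewrite signed_inv_sym signed_inv_simple_out ?oppr0. Qed.

(** For cyclically consecutive indices the source comparisons are additive, and the image
    comparisons fail additivity by at most one in the needed direction. As both given values are at
    most -1, their sum plus one is still negative. *)
Lemma signed_inv_add2 x i : i != i + 1 + 1 -> signed_inv x i (i + 1) < 0 ->
  signed_inv x (i + 1) (i + 1 + 1) < 0 -> signed_inv x i (i + 1 + 1) < 0.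
Proof.
move=> i2 /signed_inv_lt0 g1 /signed_inv_lt0 g2.
have i12 : pos (i + 1) != pos (i + 1 + 1) by rewrite (inj_eq (@pos_inj _)) eq_sym succ_neq.
have i02 : pos i != pos (i + 1 + 1) by rewrite (inj_eq (@pos_inj _)).
have i01 : pos i != pos (i + 1) by rewrite (inj_eq (@pos_inj _)) eq_sym succ_neq.
suff : signed_inv x i (i + 1 + 1) <= signed_inv x i (i + 1) + signed_inv x (i + 1) (i + 1 + 1) + 1 by lra.
rewrite {g1 g2} /signed_inv.
have : ((pos (i + 1 + 1)%R < pos i)%N = (pos (i + 1)%R < pos i)%N + (pos (i + 1 + 1)%R < pos (i + 1)%R)%N :> nat)%N.
  have [i0|i0] := eqVneq i 0.
    have i10 : i + 1 != 0 by rewrite i0 add0r oner_eq0.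
    have p0 : pos i = m.+1 by rewrite i0 pos0.
    have p1 : pos (i + 1) = 0%N by rewrite i0 add0r pos1.
    by have := pos_succS i10; lia.
  have [i10|i10] := eqVneq (i + 1) 0.
    have p1 : pos (i + 1) = m.+1 by rewrite i10 pos0.
    have p2 : pos (i + 1 + 1) = 0%N by rewrite i10 add0r pos1.
    by have := pos_succS i0; lia.
  by rewrite !pos_succS //; lia.
move/(congr1 (fun k : nat => k%:R : rat)); rewrite natrD => ->.
move: (ext_perm x i) (ext_perm x (i + 1)) (ext_perm x (i + 1 + 1)) => a b c.
have : ((pos b < pos a)%N + (pos c < pos b)%N <= 1 + (pos c < pos a)%N)%N by lia.
by rewrite -(ler_nat rat) !natrD; lra.
Qed.

(** With [i] and [i + 1] both descents of [x], three letters can be removed from the right, so [x]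
    has a reduced word ending in a side of the braid relation. *)
Lemma descent_braidl x i : i != i + 1 + 1 -> descent x i -> descent x (i + 1) ->
  descent (x * simple i)%g (i + 1) /\ descent (x * simple i * simple (i + 1))%g i.
Proof.
move=> i2 d1 d2; have [i21 i10] := (succ_neq (i + 1), succ_neq i).
have i2' : i + 1 + 1 != i by rewrite eq_sym.
have e j : signed_inv (x * simple i)%g j (i + 1 + 1)
    = signed_inv x (tperm i (i + 1) j) (i + 1 + 1).
  by rewrite signed_invMs signed_inv_simple_outr // addr0 (@tpermD _ i (i + 1) (i + 1 + 1)) // eq_sym.
rewrite /descent; split; first by rewrite e tpermR; apply: signed_inv_add2.
rewrite signed_invMs signed_inv_simple_out // 1?eq_sym // addr0 tpermL.
by rewrite (@tpermD _ (i + 1) (i + 1 + 1) i) // e tpermL.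
Qed.

Lemma descent_comm x i j : i != j -> i != j + 1 -> j != i + 1 ->
  descent (x * simple i)%g j = descent x j.
Proof.
move=> ij ij' ji; rewrite /descent signed_invMs signed_inv_simple_out ?addr0 // 1?eq_sym //.
by rewrite !tpermD // 1?eq_sym // (inj_eq (@addIr _ 1)) eq_sym.
Qed.

(** When n = 2 the two adjacent pairs are the same pair in opposite orders, so no braid relation is
    needed there. *)
Lemma descent_n2 x i : i = i + 1 + 1 -> descent x i -> ~~ descent x (i + 1).
Proof. by move=> e d; rewrite /descent -e signed_inv_sym oppr_lt0 -leNgt ltW. Qed.

End Descents.

Section WordProperty.
Variable m : nat.
Local Notation n := m.+2.
Local Notation W := (extW m).
Implicit Types (x y : W) (i j k : 'I_n) (s : seq 'I_n).

Variables (B : nzRingType) (T : B) (A : 'I_n -> B).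
Hypothesis T_tau : forall r r', (tau m ^+ r = tau m ^+ r')%g -> T ^+ r = T ^+ r'.
Hypothesis A_sqr : forall i, A i * A i = 0.
Hypothesis A_comm : forall i j, i != j -> i != j + 1 -> j != i + 1 ->
  A i * A j = A j * A i.
Hypothesis A_braid : forall i, i != i + 1 + 1 ->
  A i * A (i + 1) * A i = A (i + 1) * A i * A (i + 1).

Definition word_op (r : nat) s : B := T ^+ r * \prod_(i <- s) A i.

Definition reduced (r : nat) s : Prop :=
  double_len (tau m ^+ r * word s)%g = (size s)%:R *+ 2.

Lemma word_op_rcons r s i : word_op r (rcons s i) = word_op r s * A i.
Proof. by rewrite /word_op -cats1 big_cat big_seq1 mulrA. Qed.

Lemma tau_word_rcons r s i :
  (tau m ^+ r * word (rcons s i) = tau m ^+ r * word s * simple i)%g.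
Proof. by rewrite word_rcons mulgA. Qed.

Lemma double_len_word r s : double_len (tau m ^+ r * word s)%g <= (size s)%:R *+ 2.
Proof. exact: (@double_len_le_dec _ _ (r, s)). Qed.

Lemma reduced_rcons r s i : reduced r (rcons s i) ->
  reduced r s /\ descent (tau m ^+ r * word (rcons s i))%g i.
Proof.
rewrite /reduced size_rcons -natr1 => sE.
have := double_len_simple (tau m ^+ r * word (rcons s i))%g i.
rewrite tau_word_rcons mulgKs -tau_word_rcons sE.
have := double_len_word r s; rewrite !mulr2n; case: ifP => [d|_]; last lra.
by move=> _ iE; split=> //; move: iE; lra.
Qed.

Lemma reduced_rconsE r s i : reduced r s ->
  ~~ descent (tau m ^+ r * word s)%g i -> reduced r (rcons s i).
Proof.
rewrite /reduced => sE /negPf nd.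
by rewrite tau_word_rcons double_len_simple nd sE size_rcons -natr1; lra.
Qed.

Lemma double_len_desc x i : descent x i -> double_len (x * simple i)%g = double_len x - 2.
Proof. by move=> d; rewrite double_len_simple d. Qed.

(* If the last letters i and j differ, both are right descents of x, so x has two
   reduced words that end with the two sides of the braid relation of i and j. *)
Theorem word_property r s r' s' : size s = size s' ->
  (tau m ^+ r * word s = tau m ^+ r' * word s')%g -> reduced r s ->
  word_op r s = word_op r' s'.
Proof.
move: {-2}(size s) (erefl (size s)) => l.
elim: l r s r' s' => [|l IHl] r s r' s'.
  move=> /esym/size0nil -> /esym/size0nil ->; rewrite word_nil !mulg1 => /T_tau e _.
  by rewrite /word_op big_nil e.
case/lastP: s => // s i; case/lastP: s' => [|s' j]; rewrite !size_rcons // => -[sl] -[sl'] e red.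
have red' : reduced r' (rcons s' j) by rewrite /reduced -e red !size_rcons -sl -sl'.
have [rs di] := reduced_rcons red; have [rs' dj] := reduced_rcons red'.
rewrite -e in dj; have xE := tau_word_rcons r s i; have xE' := tau_word_rcons r' s' j.
rewrite -e in xE'; move: di dj xE xE' (red); rewrite /reduced size_rcons.
move: (tau m ^+ r * word (rcons s i))%g => x di dj xE xE' xl.
have iE : (x * simple i = tau m ^+ r * word s)%g by rewrite xE mulgKs.
have jE : (x * simple j = tau m ^+ r' * word s')%g by rewrite xE' mulgKs.
rewrite !word_op_rcons.
have [ij|ij] := eqVneq i j.
  rewrite ij; congr (_ * _); apply: (IHl _ _ _ _ sl sl' _ rs).
  by rewrite -iE -jE ij.
have braid_case r1 s1 r2 s2 k : l = size s1 -> l = size s2 ->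
    reduced r1 s1 -> reduced r2 s2 ->
    (x * simple k = tau m ^+ r1 * word s1)%g ->
    (x * simple (k + 1) = tau m ^+ r2 * word s2)%g ->
    descent x k -> descent x (k + 1) -> word_op r1 s1 * A k = word_op r2 s2 * A (k + 1).
  move=> l1 l2 red1 red2 e1 e2 d1 d2.
  have k2 : k != k + 1 + 1 by apply: contraTneq d2 => /descent_n2; apply.
  have [d12 d121] := descent_braidl k2 d1 d2.
  (* A reduced word of this element, two letters shorter than [s1], extends by [k], [k + 1] to one
     of [x * simple k] and by [k + 1], [k] to one of [x * simple (k + 1)]. *)
  have [[r3 s3] [/= yE sE]] := exists_dec (x * simple k * simple (k + 1) * simple k)%g.
  rewrite /is_dec /= in yE.
  have l3 : l = (size s3).+2.
    move: sE; rewrite !double_len_desc // xl -sl => sE.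
    apply/eqP; rewrite -(eqr_nat rat) -!natr1; move: sE; rewrite -!natr1 !mulr2n => sE.
    by apply/eqP; lra.
  rewrite (IHl _ _ r3 (rcons (rcons s3 k) (k + 1)) l1) ?size_rcons //; last first.
    by rewrite -e1 !tau_word_rcons -yE !mulgKs.
  rewrite (IHl _ _ r3 (rcons (rcons s3 (k + 1)) k) l2) ?size_rcons //; last first.
    rewrite -e2 !tau_word_rcons -yE -!mulgA; congr (x * _)%g.
    by rewrite !mulgA simple_braid // !mulgKs.
  rewrite !word_op_rcons; move: (word_op r3 s3) => b.
  by rewrite -!mulrA [A k * _]mulrA A_braid // !mulrA.
have [ji|ji] := eqVneq j (i + 1).
  by rewrite ji in jE dj *; apply: braid_case.
have [ij'|ij'] := eqVneq i (j + 1).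
  by rewrite ij' in iE di *; apply/esym/braid_case.
have [[r3 s3] [/= yE sE]] := exists_dec (x * simple i * simple j)%g.
rewrite /is_dec /= in yE.
have l3 : l = (size s3).+1.
  move: sE; rewrite !double_len_desc ?descent_comm // xl -sl => sE.
  apply/eqP; rewrite -(eqr_nat rat) -!natr1; move: sE; rewrite -!natr1 !mulr2n => sE.
  by apply/eqP; lra.
rewrite (IHl _ _ r3 (rcons s3 j) sl) ?size_rcons //; last first.
  by rewrite -iE tau_word_rcons -yE mulgKs.
rewrite (IHl _ _ r3 (rcons s3 i) sl') ?size_rcons //; last first.
  by rewrite -jE tau_word_rcons -yE -(mulgA x) simple_comm // mulgA mulgKs.
by rewrite !word_op_rcons; move: (word_op r3 s3) => b; rewrite -!mulrA (A_comm ij).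
Qed.

(** If appending [i] to a reduced word lowers the length, that word can be replaced by one ending in
    [i], and [A_sqr] kills the product. *)
Lemma word_op_neq0_reduced r s : word_op r s != 0 -> reduced r s.
Proof.
elim/last_ind: s => [|s i IHs]; first by rewrite /reduced word_nil mulg1 double_len_tauX.
rewrite word_op_rcons => ne; have rs : reduced r s.
  by apply: IHs; apply: contraNneq ne => ->; rewrite mul0r.
apply: reduced_rconsE => //; apply: contraNN ne => di.
have [[r1 s1] [/= yE sE]] := exists_dec (tau m ^+ r * word s * simple i)%g.
rewrite /is_dec /= in yE; have sz : size s = size (rcons s1 i).
  move: sE; rewrite double_len_desc // size_rcons rs => sE.
  apply/eqP; rewrite -(eqr_nat rat) -natr1; move: sE; rewrite !mulr2n => sE.
  by apply/eqP; lra.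
rewrite (word_property (r' := r1) sz _ rs) ?word_op_rcons; last first.
  by rewrite tau_word_rcons -yE mulgKs.
by move: (word_op r1 s1) => b; rewrite -mulrA A_sqr mulr0.
Qed.

Lemma word_op_descent r s i : reduced r s -> descent (tau m ^+ r * word s)%g i ->
  exists b : B, word_op r s = b * A i.
Proof.
move=> rs di; have [[r1 s1] [/= yE sE]] := exists_dec (tau m ^+ r * word s * simple i)%g.
rewrite /is_dec /= in yE; have sz : size s = size (rcons s1 i).
  move: sE; rewrite double_len_desc // size_rcons rs => sE.
  apply/eqP; rewrite -(eqr_nat rat) -natr1; move: sE; rewrite !mulr2n => sE.
  by apply/eqP; lra.
exists (word_op r1 s1); rewrite (word_property (r' := r1) sz _ rs) ?word_op_rcons //.
by rewrite tau_word_rcons -yE mulgKs.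
Qed.

End WordProperty.

(** * Elements supported on translations *)

Section TwistedProjection.
Variables (F : fieldType) (W : groupType) (act : field_action F W).
Local Notation tw := (twisted_alg act).
Local Notation supp := (@monalg.msupp W F).
Local Notation U := (@mkmalgU W F).
Local Notation cf := (@monalg.mcoeff W F).
Local Notation actW := (fa_act act).
Implicit Types (v w u : W) (p q : F) (x y : tw).

Lemma tw_mulE x y : x * y = tw_mul act x y.
Proof. by []. Qed.

Lemma cf_grpl w u x : cf (w * u)%g (grp act w * x) = actW w (cf u x).
Proof.
rewrite tw_mulE [in LHS](monalg.monalgE x) [in RHS](monalg.monalgE x).
rewrite tw_mul_sumr !raddf_sum /=; apply: eq_bigr => v _.
rewrite tw_mulUU mul1r !monalg.mcoeffU (inj_eq (mulgI w)).
by rewrite raddfMn.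
Qed.

Lemma cf_grpr w u x : cf (u * w)%g (x * grp act w) = cf u x.
Proof.
rewrite tw_mulE [in LHS](monalg.monalgE x) [in RHS](monalg.monalgE x).
rewrite tw_mul_suml !raddf_sum /=; apply: eq_bigr => v _.
by rewrite tw_mulUU rmorph1 mulr1 !monalg.mcoeffU (inj_eq (mulIg w)).
Qed.

Lemma cf_mul_scalar w x p : cf w (x * p%:A) = cf w x * actW w p.
Proof.
rewrite tw_mulE [p%:A]tw_scaleU mulr1 [in LHS](monalg.monalgE x) [in RHS](monalg.monalgE x).
rewrite tw_mul_suml !raddf_sum /= mulr_suml; apply: eq_bigr => v _.
rewrite tw_mulUU mulg1 !monalg.mcoeffU mulrnAl.
by have [->|_] := eqVneq v w; rewrite ?mulr0n ?mul0r.
Qed.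

Lemma cf_scale w p x : cf w (p *: x) = p * cf w x.
Proof. exact: monalg.mcoeffZ. Qed.

Variable h : W -> W.

Definition proj x : tw := \sum_(w <- supp x) U (h w) (cf w x).

Lemma projw (d : {fset W}) x : (supp x `<=` d)%fset ->
  proj x = \sum_(w <- d) U (h w) (cf w x).
Proof.
move=> le; rewrite /proj; apply: big_fset_incl => // w _ /monalg.mcoeff_outdom ->.
by rewrite raddf0.
Qed.

Lemma projD x y : proj (x + y) = proj x + proj y.
Proof.
rewrite (projw (monalg.msuppD_le x y)) (projw (fsubsetUl _ (supp y))).
rewrite (projw (fsubsetUr (supp x) _)) -big_split /=; apply: eq_bigr => w _.
by rewrite raddfD /= raddfD.
Qed.

Lemma proj0 : proj 0 = 0.
Proof. by apply: (addrI (proj 0)); rewrite -projD !addr0. Qed.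

Lemma projN x : proj (- x) = - proj x.
Proof. by apply: (addrI (proj x)); rewrite -projD !subrr proj0. Qed.

Lemma proj_sum (I : Type) (r : seq I) (P : pred I) (G : I -> tw) :
  proj (\sum_(i <- r | P i) G i) = \sum_(i <- r | P i) proj (G i).
Proof. exact: (big_morph proj projD proj0). Qed.

Lemma projU w p : proj (U w p) = U (h w) p.
Proof.
by rewrite (projw monalg.msuppU_le) big_seq_fset1 monalg.mcoeffUU.
Qed.

Lemma projZ p x : proj (p *: x) = p *: proj x.
Proof.
rewrite [in LHS](monalg.monalgE x) scaler_sumr proj_sum scaler_sumr.
by apply: eq_bigr => w _; rewrite !tw_scaleU projU.
Qed.

(** The hypothesis on [h] says that applying [h] to the right factor first does not affect the final
    label. For [transl_part] it holds because a translation part of a product ignores the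
    permutation of the right factor. *)
Lemma projM x y : (forall v w, h (v * h w)%g = h (v * w)%g) ->
  proj (x * y) = proj (x * proj y).
Proof.
move=> hM; transitivity (\sum_(v <- supp x) \sum_(w <- supp y)
    (U (h (v * w)%g) (cf v x * actW v (cf w y)) : tw)).
  rewrite tw_mulE /tw_mul proj_sum; apply: eq_bigr => v _.
  by rewrite proj_sum; apply: eq_bigr => w _; rewrite projU.
rewrite tw_mulE [X in tw_mul act X _](monalg.monalgE x) tw_mul_suml proj_sum.
apply: eq_bigr => v _; rewrite {2}/proj tw_mul_sumr proj_sum; apply: eq_bigr => w _.
by rewrite tw_mulUU projU hM.
Qed.

Definition fixed_supp x : Prop := forall w, cf w x != 0 -> h w = w.

Lemma proj_id x : fixed_supp x -> proj x = x.
Proof.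
move=> fx; rewrite [RHS]monalg.monalgE /proj big_seq [RHS]big_seq.
by apply: eq_bigr => w; rewrite -monalg.mcoeff_neq0 => /fx ->.
Qed.

Lemma fixed_suppU w p : h w = w -> fixed_supp (U w p).
Proof.
by move=> hw v; rewrite monalg.mcoeffU; have [<-|_] := eqVneq w v => //; rewrite eqxx.
Qed.

Lemma fixed_suppD x y : fixed_supp x -> fixed_supp y -> fixed_supp (x + y).
Proof.
move=> fx fy w; rewrite monalg.mcoeffD.
have [->|/fx //] := eqVneq (cf w x) 0; rewrite add0r; exact: fy.
Qed.

Lemma fixed_suppN x : fixed_supp x -> fixed_supp (- x).
Proof. by move=> fx w; rewrite monalg.mcoeffN oppr_eq0; apply: fx. Qed.

Lemma fixed_supp0 : fixed_supp 0.
Proof. by move=> w; rewrite monalg.mcoeff0 eqxx. Qed.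

Lemma fixed_supp_sum (x : tw) (G : W -> tw) :
  (forall w, cf w x != 0 -> fixed_supp (G w)) ->
  fixed_supp (\sum_(w <- supp x) G w).
Proof.
move=> fG; rewrite big_seq.
apply: (big_ind fixed_supp); [exact: fixed_supp0 | exact: fixed_suppD |].
by move=> w; rewrite -monalg.mcoeff_neq0; apply: fG.
Qed.

Lemma fixed_suppM x y : (forall v w, h v = v -> h w = w -> h (v * w)%g = (v * w)%g) ->
  fixed_supp x -> fixed_supp y -> fixed_supp (x * y).
Proof.
move=> hM fx fy; rewrite tw_mulE /tw_mul.
apply: fixed_supp_sum => v /fx hv; apply: fixed_supp_sum => w /fy hw.
by apply/fixed_suppU/hM.
Qed.

Lemma fixed_supp_comm x y :
  (forall v w, h v = v -> h w = w -> (v * w = w * v)%g) ->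
  (forall v p, h v = v -> actW v p = p) ->
  fixed_supp x -> fixed_supp y -> x * y = y * x.
Proof.
move=> hC hA fx fy; rewrite !tw_mulE /tw_mul exchange_big /=.
rewrite big_seq [RHS]big_seq; apply: eq_bigr => w; rewrite -monalg.mcoeff_neq0 => /fy hw.
rewrite big_seq [RHS]big_seq; apply: eq_bigr => v; rewrite -monalg.mcoeff_neq0 => /fx hv.
by rewrite !hA // (hC v w) // mulrC.
Qed.

Lemma fixed_suppJ v x : (forall w, h w = w -> h (v * w * v^-1)%g = (v * w * v^-1)%g) ->
  fixed_supp x -> fixed_supp (grp act v * x * grp act v^-1).
Proof.
move=> hJ fx w; have -> : w = (v * (v^-1 * w * v) * v^-1)%g by rewrite !mulgA mulgV mul1g mulgK.
rewrite cf_grpr cf_grpl fmorph_eq0 => /fx; exact: hJ.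
Qed.

Lemma fixed_supp_scalar p : h 1%g = 1%g -> fixed_supp p%:A.
Proof.
by move=> h1; rewrite [p%:A]tw_scaleU; apply: fixed_suppU.
Qed.

End TwistedProjection.

Section TranslationAlgebra.
Variables (K : fieldType) (m : nat).
Local Notation n := m.+2.
Local Notation W := (extW m).
Local Notation tw := (twalg K m).
Local Notation act := (weyl_action K m).
Local Notation F := (fracS K m).
Implicit Types (v w : W) (i j k : 'I_n) (p : F).

Definition transl_part w : W := transl (ext_tr w).

Lemma transl_partP w : transl_part w = w <-> ext_perm w = 1%g.
Proof. by case: w => t s; split=> [[<-]|/= ->]. Qed.

Lemma transl_partM v w : transl_part (v * transl_part w)%g = transl_part (v * w)%g.
Proof. by []. Qed.

Lemma transl_part_mul v w : transl_part v = v -> transl_part w = w ->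
  transl_part (v * w)%g = (v * w)%g.
Proof.
by rewrite !transl_partP => v1 w1; apply/permP => i; rewrite ext_permM v1 w1 !perm1.
Qed.

Lemma transl_part_comm v w : transl_part v = v -> transl_part w = w ->
  (v * w = w * v)%g.
Proof.
rewrite !transl_partP => v1 w1; apply: extW_ext => [|i]; last by rewrite !ext_permM v1 w1.
by rewrite !ext_trM v1 w1 !perm_coweight1 addrC.
Qed.

Lemma transl_part_act w p : transl_part w = w -> fa_act act w p = p.
Proof. by rewrite transl_partP => w1; rewrite /= /weyl_act w1 actF1. Qed.

Lemma transl_part_conj v w : transl_part w = w ->
  transl_part (v * w * v^-1)%g = (v * w * v^-1)%g.
Proof.
rewrite !transl_partP => w1; apply/permP => i.
by rewrite !ext_permM w1 !perm1 -ext_permM mulgV ext_perm1.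
Qed.

Definition tproj : tw -> tw := proj transl_part.

Definition transl_supp : {pred tw} := fun x => `[< fixed_supp transl_part x >].

Lemma transl_suppP x : reflect (fixed_supp transl_part x) (x \in transl_supp).
Proof. exact: asboolP. Qed.

Fact transl_supp_subring : subring_closed transl_supp.
Proof.
split=> [|x y /transl_suppP fx /transl_suppP fy|x y /transl_suppP fx /transl_suppP fy].
- apply/transl_suppP; exact: (@fixed_suppU _ _ act transl_part 1%g 1).
- by apply/transl_suppP/fixed_suppD/fixed_suppN.
exact/transl_suppP/(fixed_suppM transl_part_mul).
Qed.
HB.instance Definition _ := GRing.isSubringClosed.Build tw transl_supp
  transl_supp_subring.

(** Packaged as a ring of its own, which is commutative, so that determinants and divided
    differences can be formed in it. *)
Record transl_alg := TranslAlg { ta_val :> tw; _ : ta_val \in transl_supp }.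
HB.instance Definition _ := [isSub for ta_val].
HB.instance Definition _ := [Choice of transl_alg by <:].
HB.instance Definition _ := [SubChoice_isSubNzRing of transl_alg by <:].

Fact transl_alg_mulC : commutative (@GRing.mul transl_alg).
Proof.
move=> x y; apply: val_inj; rewrite !rmorphM.
apply: (fixed_supp_comm transl_part_comm transl_part_act);
  apply/transl_suppP; exact: valP.
Qed.
HB.instance Definition _ :=
  GRing.PzRing_hasCommutativeMul.Build transl_alg transl_alg_mulC.

End TranslationAlgebra.

(** * Divided differences and minors *)

Section DividedDifference.
Variables (E : comNzRingType) (sg : {rmorphism E -> E}) (c : E).

Definition divdiff (g : E) : E := c * (sg g - g).

Lemma divdiff_zmod : zmod_morphism divdiff.
Proof. by move=> g h; rewrite /divdiff rmorphB; ring. Qed.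
HB.instance Definition _ := GRing.isZmodMorphism.Build E E divdiff divdiff_zmod.

Lemma divdiff_fix g : sg g = g -> divdiff g = 0.
Proof. by move=> e; rewrite /divdiff e subrr mulr0. Qed.

Lemma divdiff_mul g h : divdiff (g * h) = divdiff g * h + sg g * divdiff h.
Proof. by rewrite /divdiff rmorphM; ring. Qed.

Lemma fix_divdiff u g : c * u = 1 -> divdiff g = 0 -> sg g = g.
Proof.
move=> cu g0; apply/eqP; rewrite -subr_eq0; apply/eqP.
by rewrite -[LHS]mul1r -cu mulrAC -/(divdiff g) g0 mul0r.
Qed.

Hypothesis sgK : involutive sg.
Hypothesis sgc : sg c = - c.

Lemma sg_divdiff g : sg (divdiff g) = divdiff g.
Proof. by rewrite /divdiff rmorphM rmorphB /= sgK sgc; ring. Qed.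

Lemma divdiff_dd g : divdiff (divdiff g) = 0.
Proof. exact/divdiff_fix/sg_divdiff. Qed.

End DividedDifference.

Section MinorsOfDividedDifferences.
Variables (E : comNzRingType) (N : nat).
Variables (sg : nat -> {rmorphism E -> E}) (c a : nat -> E) (x1 : E).
Local Notation D i := (divdiff (sg i) (c i)).
Hypothesis sgK : forall i, (0 < i <= N)%N -> involutive (sg i).
Hypothesis sgc : forall i, (0 < i <= N)%N -> sg i (c i) = - c i.
Hypothesis ca : forall i, (0 < i <= N)%N -> c i * (a i - a i.+1) = 1.
Hypothesis sga : forall i, (0 < i <= N)%N -> sg i (a i) = a i.+1.
Hypothesis sga1 : forall i, (1 < i <= N)%N -> sg i (a 1) = a 1.
Hypothesis sgx : forall i, (1 < i <= N)%N -> sg i x1 = x1.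
Hypothesis D_braid : forall i g, (0 < i)%N -> (i < N)%N ->
  D i (D i.+1 (D i g)) = D i.+1 (D i (D i.+1 g)).
Hypothesis D_comm : forall i j g, (0 < i)%N -> (i.+1 < j)%N -> (j <= N)%N ->
  D i (D j g) = D j (D i g).

(** The entries [M_{p,l}]; the value 0 at [l = 0] is the convention that makes [divdiffs_rec] hold
    for [l = 1]. *)
Fixpoint divdiffs (p l : nat) : E :=
  match l with
  | 0 => 0
  | 1 => (- a 1) ^+ p * x1
  | l'.+1 => D l' (divdiffs p l')
  end.

Lemma divdiffsS p l : (0 < l)%N -> divdiffs p l.+1 = D l (divdiffs p l).
Proof. by case: l. Qed.

(** Strong induction on the column. The last operator applied squares to zero. The one before it is
    handled by the braid relation, which brings [D l.+1] next to column [l], killed by induction.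
    All the others commute past. *)
Lemma divdiffs_fix p l i : (0 < i <= N)%N -> (l <= N.+1)%N -> l != i -> D i (divdiffs p l) = 0.
Proof.
elim/ltn_ind: l i => -[_ i _ _ _|[_ i|l IHl i]].
- by rewrite raddf0.
- move=> /andP[i0 iN] _; rewrite eq_sym => i1; have {i1}i0 : (1 < i)%N by rewrite ltn_neqAle eq_sym i1.
  apply: divdiff_fix; rewrite /= rmorphM rmorphXn rmorphN /=.
  by rewrite sga1 ?sgx ?i0.
move=> iN lN li; rewrite divdiffsS //.
have lr : (0 < l.+1 <= N)%N by [].
have [il|il] := eqVneq i l.+1.
  by rewrite il; apply: divdiff_dd; [apply: sgK | apply: sgc].
have [il1|il1] := eqVneq i l.
  rewrite {}il1 in il li iN *; have [l0 lN'] := andP iN.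
  rewrite divdiffsS // D_braid // (IHl l) ?raddf0 //; first by rewrite ltnW.
have D0 : D i (divdiffs p l.+1) = 0 by apply: IHl => //; [apply: ltnW | rewrite eq_sym].
have [i_l|l_i] := leqP i.+1 l.
  by rewrite D_comm ?D0 ?raddf0 //; lia.
by rewrite -D_comm ?D0 ?raddf0 //; lia.
Qed.

(** The case [l = 1] is the definition. Applying [D l] to the identity for column [l] gives the next
    one by the Leibniz rule, since [D l (a l) = -1] and [sg l] sends [a l] to [a l.+1]. *)
Lemma divdiffs_rec p l : (0 < l <= N.+1)%N -> divdiffs p.+1 l = divdiffs p l.-1 - a l * divdiffs p l.
Proof.
elim: l => // -[_ _|l IHl lN]; first by rewrite /= exprS; ring.
have lr : (0 < l.+1 <= N)%N by [].
rewrite divdiffsS // IHl; last by rewrite /= ltnW.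
have -> : D l.+1 (divdiffs p l - a l.+1 * divdiffs p l.+1)
    = D l.+1 (divdiffs p l) - D l.+1 (a l.+1 * divdiffs p l.+1) by rewrite raddfB.
rewrite divdiffs_fix //; [|exact/ltnW/ltnW|by rewrite neq_ltn ltnSn].
rewrite divdiff_mul sga // sub0r opprD; congr (_ + _).
have -> : D l.+1 (a l.+1) = -1.
  by rewrite /divdiff sga // -opprB mulrN ca.
by rewrite mulN1r opprK.
Qed.

(* Coefficients of prod_(0 < r <= p) (t + a r) in powers of t. *)
Fixpoint unitri (p q : nat) : E :=
  if p is p'.+1 then (if q is q'.+1 then unitri p' q' else 0) + a p * unitri p' q
  else (q == 0%N)%:R.

Lemma unitri_gt p q : (p < q)%N -> unitri p q = 0.
Proof.
elim: p q => [|p IHp] [|q] //= pq; rewrite !IHp ?mulr0 ?addr0 //; exact: ltnW.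
Qed.

Lemma unitri_diag p : unitri p p = 1.
Proof. by elim: p => //= p IHp; rewrite IHp unitri_gt ?mulr0 ?addr0. Qed.

Lemma unitri_sum p (G : nat -> E) :
  \sum_(q < p.+2) unitri p.+1 q * G q =
  \sum_(q < p.+1) unitri p q * G q.+1 + a p.+1 * \sum_(q < p.+1) unitri p q * G q.
Proof.
rewrite big_ord_recl /= add0r.
under eq_bigr do rewrite /bump /= add1n mulrDl.
rewrite big_split /= addrCA; congr (_ + _).
rewrite [\sum_(q < p.+1) a p.+1 * _ * _]big_ord_recr /= (@unitri_gt p p.+1) // mulr0 mul0r addr0.
rewrite [in RHS]big_ord_recl /= mulrDr mulrA; congr (_ + _).
by rewrite mulr_sumr; apply: eq_bigr => q _; rewrite mulrA.
Qed.

Variable z : nat -> nat -> E.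
Hypothesis z0 : forall i, z i 0 = 0.
Hypothesis z1 : forall l, (0 < l <= N.+1)%N -> z 1 l = divdiffs 0 l.
Hypothesis z_rec : forall i l, (0 < i <= N)%N -> (0 < l <= N.+1)%N ->
  z i.+1 l = z i l.-1 + (a i - a l) * z i l.

(** By [divdiffs_rec], raising the exponent in [divdiffs] by one sends the entry at [l] to that at
    [l.-1] minus [a l] times the entry. The recursion of [z] adds [a i] to this operator, so row
    [p.+1] is obtained from the first row by the product whose coefficients are [unitri]. *)
Lemma z_divdiffs p l : (p <= N)%N -> (l <= N.+1)%N ->
  z p.+1 l = \sum_(q < p.+1) unitri p q * divdiffs q l.
Proof.
elim: p l => [|p IHp] [|l] pN lN.
- by rewrite z0 big_ord1 mulr0.
- by rewrite z1 // big_ord1 mul1r.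
- by rewrite z0 big1 // => q _; rewrite mulr0.
rewrite z_rec ?pN // IHp ?(ltnW pN) ?(ltnW lN) // IHp ?(ltnW pN) //.
rewrite (unitri_sum _ (fun q => divdiffs q l.+1)).
have -> : \sum_(q < p.+1) unitri p q * divdiffs q.+1 l.+1 =
    \sum_(q < p.+1) unitri p q * divdiffs q l - a l.+1 * \sum_(q < p.+1) unitri p q * divdiffs q l.+1.
  rewrite mulr_sumr -sumrB; apply: eq_bigr => q _.
  by rewrite divdiffs_rec //=; ring.
by ring.
Qed.

Definition zdet k (col : 'I_k -> nat) := \det (\matrix_(p < k, q < k) z p.+1 (col q)).

(** The two matrices differ by the left factor [unitri], which is unitriangular on the first [k]
    rows. *)
Lemma zdetE k (col : 'I_k -> nat) : (k <= N.+1)%N -> (forall q, (col q <= N.+1)%N) ->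
  zdet col = \det (\matrix_(p < k, q < k) divdiffs p (col q)).
Proof.
move=> kN colN; rewrite /zdet.
have -> : \matrix_(p < k, q < k) z p.+1 (col q) =
    (\matrix_(p < k, q < k) unitri p q) *m (\matrix_(p < k, q < k) divdiffs p (col q)).
  apply/matrixP => p q; rewrite !mxE z_divdiffs //; last by rewrite -ltnS (leq_trans (ltn_ord p)).
  under [RHS]eq_bigr do rewrite !mxE.
  rewrite (big_ord_widen k (fun r => unitri p r * divdiffs r (col q))) // big_mkcond /=.
  apply: eq_bigr => r _; case: ltnP => // pr; by rewrite unitri_gt ?mul0r.
rewrite det_mulmx det_trig ?big1 ?mul1r //.
  by move=> p _; rewrite mxE unitri_diag.
by apply/is_trig_mxP => p q pq; rewrite mxE unitri_gt.
Qed.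

(** Expansion along column [q0]: the cofactors involve only columns fixed by [sg (col q0)], so the
    divided difference falls on the entries of column [q0] alone. *)
Lemma divdiff_zdet k (col col' : 'I_k -> nat) q0 : (k <= N.+1)%N ->
  (forall q, (col q <= N.+1)%N) -> (0 < col q0 <= N)%N ->
  (forall q, q != q0 -> col q != col q0) ->
  col' q0 = (col q0).+1 -> (forall q, q != q0 -> col' q = col q) ->
  D (col q0) (zdet col) = zdet col'.
Proof.
move=> kN colN c0 cne col'q0 col'q.
have col'N q : (col' q <= N.+1)%N.
  by have [->|qq] := eqVneq q q0; [rewrite col'q0 ltnS; case/andP: c0 | rewrite col'q].
rewrite !zdetE // !(expand_det_col _ q0) raddf_sum; apply: eq_bigr => p _ /=.
set A := \matrix_(p0, q) _; set A' := \matrix_(p0, q) divdiffs p0 (col' q).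
have cofE : cofactor A' p q0 = cofactor A p q0.
  rewrite /cofactor; congr (_ * \det _); apply/matrixP => r s; rewrite !mxE col'q //.
  by rewrite eq_sym neq_lift.
have sg_cof : sg (col q0) (cofactor A p q0) = cofactor A p q0.
  rewrite /cofactor rmorphM rmorphXn rmorphN1 -det_map_mx; congr (_ * \det _).
  apply/matrixP => r s; rewrite !mxE.
  apply: (fix_divdiff (ca c0)); apply: divdiffs_fix => //; apply: cne.
  by rewrite eq_sym neq_lift.
rewrite divdiff_mul cofE (divdiff_fix _ sg_cof) mulr0 addr0 !mxE col'q0 divdiffsS //.
by case/andP: c0.
Qed.

End MinorsOfDividedDifferences.

(** * The nilHecke generators as divided differences *)

Section RingConjugation.
Variables (R : nzRingType) (a b : R).

Lemma conjr1 : a * b = 1 -> a * 1 * b = 1.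
Proof. by rewrite mulr1. Qed.

Lemma conjrM x y : b * a = 1 -> a * (x * y) * b = a * x * b * (a * y * b).
Proof. by move=> ba; rewrite !mulrA -(mulrA _ b) ba mulr1. Qed.

Lemma conjr_comp c d e f x : a * c = e -> d * b = f ->
  a * (c * x * d) * b = e * x * f.
Proof. by move=> <- <-; rewrite !mulrA. Qed.

Lemma conjr_id x : a = 1 -> b = 1 -> a * x * b = x.
Proof. by move=> -> ->; rewrite mul1r mulr1. Qed.

End RingConjugation.

Lemma conjr_scal (F : fieldType) (L : lalgType F) (a b : L) (p q : F) :
  a * b = 1 -> a * p%:A = q *: a -> a * p%:A * b = q%:A.
Proof. by move=> ab ->; rewrite -scalerAl ab. Qed.

Section ModuleProjection.
Variables (F : fieldType) (L : lalgType F) (f : L -> L).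
Hypothesis fZ : forall c x, f (c *: x) = c *: f x.
Hypothesis fB : forall x y, f (x - y) = f x - f y.
Hypothesis fM : forall x y, f (x * y) = f (x * f y).
Hypothesis f1 : f 1 = 1.
Implicit Types (c : F) (x g s t : L).

Lemma mproj_diff c s : f s = 1 -> f (c *: (s - 1)) = 0.
Proof. by move=> fs; rewrite fZ fB fs f1 subrr scaler0. Qed.

Lemma mproj_mul_diff c s x : f s = 1 -> f (x * (c *: (s - 1))) = 0.
Proof.
by move=> /(mproj_diff c) e; rewrite fM e mulr0; have := fB 0 0; rewrite !subrr.
Qed.

(** A right factor [t] with [f t = 1] is invisible to [f]. It may be appended to [s * g], which
    becomes the conjugate of [g] when [t] is the inverse of [s]. *)
Lemma mproj_diff_mul c s t g : f t = 1 -> f g = g -> f (s * g * t) = s * g * t ->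
  f (c *: (s - 1) * g) = c%:A * (s * g * t - g).
Proof.
move=> ft fg e; rewrite -scalerAl mulrBl mul1r fZ fB fg mulr_algl -[in RHS]e.
by rewrite (fM (s * g)) ft mulr1.
Qed.

End ModuleProjection.

Section DividedDifferences.
Variables (K : fieldType) (m : nat).
Local Notation n := m.+2.
Local Notation W := (extW m).
Local Notation tw := (twalg K m).
Local Notation act := (weyl_action K m).
Local Notation F := (fracS K m).
Local Notation E := (transl_alg K m).
Local Notation tproj := (@tproj K m).
Implicit Types (v w : W) (i j k : 'I_n) (p q : F) (x y : tw) (g h : E).

Lemma ta_valP g : fixed_supp (@transl_part m) (val g).
Proof. exact/transl_suppP/valP. Qed.

Fact tscal_in p : (p%:A : tw) \in @transl_supp K m.
Proof. exact/transl_suppP/fixed_supp_scalar. Qed.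

Definition tscal p : E := TranslAlg (tscal_in p).

Fact tscal_zmod : zmod_morphism tscal.
Proof. by move=> p q; apply: val_inj; rewrite rmorphB /= scalerBl. Qed.
HB.instance Definition _ := GRing.isZmodMorphism.Build F E tscal tscal_zmod.

Fact tscal_monoid : monoid_morphism tscal.
Proof.
split=> [|p q]; apply: val_inj; first by rewrite /= scale1r.
by rewrite rmorphM /= mulr_algl scalerA.
Qed.
HB.instance Definition _ := GRing.isMonoidMorphism.Build F E tscal tscal_monoid.

Fact conj_in w g : grp act w * val g * grp act w^-1%g \in @transl_supp K m.
Proof.
apply/transl_suppP; apply: fixed_suppJ; last exact: ta_valP.
exact: transl_part_conj.
Qed.

(** For a simple reflection this is the simultaneous exchange of the scalars [a_] and of the
    monomials, see [tconj_scal] and [tconj_tX]. *)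
Definition tconj w g : E := TranslAlg (conj_in w g).

Fact tconj_zmod w : zmod_morphism (tconj w).
Proof. by move=> g h; apply: val_inj; rewrite rmorphB /= mulrBr mulrBl. Qed.
HB.instance Definition _ w := GRing.isZmodMorphism.Build E E (tconj w) (tconj_zmod w).

Lemma grpV w : grp act w * grp act w^-1%g = 1.
Proof. by rewrite grpM mulgV. Qed.

Lemma grpVl w : grp act w^-1%g * grp act w = 1.
Proof. by rewrite grpM mulVg. Qed.

Fact tconj_monoid w : monoid_morphism (tconj w).
Proof.
split=> [|g h]; apply: val_inj; first exact: (conjr1 (grpV w)).
exact: (conjrM _ _ (grpVl w)).
Qed.
HB.instance Definition _ w := GRing.isMonoidMorphism.Build E E (tconj w) (tconj_monoid w).

Lemma tconj_scal w p : tconj w (tscal p) = tscal (fa_act act w p).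
Proof. by apply: val_inj; apply: (conjr_scal (grpV w) (grp_scale _ _ _)). Qed.

Lemma tconj_comp v w g : tconj v (tconj w g) = tconj (v * w)%g g.
Proof.
apply: val_inj; apply: conjr_comp; first exact: grpM.
by apply: (etrans (grpM _ _ _)); rewrite -invMg.
Qed.

Lemma tconj1 g : tconj 1%g g = g.
Proof. by apply: val_inj; apply: conjr_id; rewrite ?invg1. Qed.

Fact tmonom_in (t : coweight m) : grp act (transl t) \in @transl_supp K m.
Proof. exact/transl_suppP/fixed_suppU. Qed.

Definition tmonom t : E := TranslAlg (tmonom_in t).

Lemma transl_conj w (t : coweight m) :
  (w * transl t * w^-1 = transl (perm_coweight (ext_perm w) t))%g.
Proof.
apply/(canLR (mulgK w)); apply: extW_ext => [|i]; last by rewrite !ext_permM !perm1.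
by rewrite !ext_trM perm_coweight1 addrC.
Qed.

Lemma grpMl v w u : (v * w = u)%g -> grp act v * grp act w = grp act u.
Proof. by move=> <-; apply: grpM. Qed.

Lemma tconj_tX w t : tconj w (tmonom t) = tmonom (perm_coweight (ext_perm w) t).
Proof.
apply: val_inj; apply: (etrans (congr1 (fun x : tw => x * grp act w^-1%g) (grpM _ _ _))).
exact/grpMl/transl_conj.
Qed.

Lemma tmonom0 : tmonom 0 = 1.
Proof. exact: val_inj. Qed.

Notation DE i := (divdiff (tconj (simple i)) (tscal (alpha K i)%:F^-1)).

Lemma tconj_simpleK i : involutive (tconj (simple i)).
Proof. by move=> g; rewrite tconj_comp simple2 tconj1. Qed.

Lemma tconj_alphaV i : tconj (simple i) (tscal (alpha K i)%:F^-1) = - tscal (alpha K i)%:F^-1.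
Proof. by rewrite tconj_scal fmorphV act_alpha_sym invrN rmorphN. Qed.

Lemma tproj_mul x y : tproj (x * y) = tproj (x * tproj y).
Proof. exact/projM/transl_partM. Qed.

Lemma tproj_val g : tproj (val g) = val g.
Proof. exact/proj_id/ta_valP. Qed.

Lemma tproj_grp w : tproj (grp act w) = val (tmonom (ext_tr w)).
Proof. exact: projU. Qed.

Lemma transl_part1 i : i != 0 -> tproj (grp act (simple i)) = 1.
Proof. by move=> i0; rewrite tproj_grp ext_tr_simple (negPf i0) tmonom0. Qed.

Lemma tproj_scale p x : tproj (p *: x) = p *: tproj x.
Proof. exact: projZ. Qed.

Lemma tprojB x y : tproj (x - y) = tproj x - tproj y.
Proof. by rewrite /tproj projD projN. Qed.

Lemma tproj1 : tproj 1 = 1.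
Proof. exact: (tproj_val 1). Qed.

Lemma simpleV i : (simple i)^-1%g = simple i.
Proof. by apply: (mulgI (simple i)); rewrite mulgV simple2. Qed.

Lemma tproj_mulA i x : i != 0 -> tproj (x * A_simple K i) = 0.
Proof.
move=> /transl_part1.
exact: (mproj_mul_diff tproj_scale tprojB tproj_mul tproj1).
Qed.

Lemma tproj_Amul i g : i != 0 ->
  tproj (A_simple K i * val g) = val (DE i g).
Proof.
move=> i0; have t1 : tproj (grp act (simple i)^-1%g) = 1.
  by rewrite simpleV; apply: transl_part1.
apply: (etrans (mproj_diff_mul tproj_scale tprojB tproj_mul _ t1 (tproj_val g)
  (tproj_val (tconj (simple i) g)))).
by rewrite /divdiff rmorphM rmorphB.
Qed.

End DividedDifferences.

(** * The Peterson basis as projections of the [A_ K w] *)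

Lemma conj_word (R : nzRingType) (m : nat) (t : R) (b : 'I_m.+2 -> R) (r : nat) s :
  (forall i, t * b i = b (i + 1) * t) ->
  t ^+ r * \prod_(i <- s) b i = \prod_(i <- [seq i + r%:R | i <- s]) b i * t ^+ r.
Proof.
move=> tb; have tbr i : t ^+ r * b i = b (i + r%:R) * t ^+ r.
  elim: r i => [|r IHr] i; first by rewrite expr0 mul1r mulr1 addr0.
  by rewrite exprSr -mulrA tb mulrA IHr -mulrA addrAC -addrA natr1.
elim: s => [|i s IHs]; first by rewrite !big_nil mulr1 mul1r.
by rewrite /= !big_cons mulrA tbr -mulrA IHs mulrA.
Qed.

Lemma prod_braid (R : nzRingType) (I : Type) (b : I -> R) (i k : I) :
  b i * b k * b i = b k * b i * b k ->
  \prod_(l <- [:: i; k; i]) b l = \prod_(l <- [:: k; i; k]) b l.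
Proof. by move=> e; rewrite !big_cons big_nil !mulr1 !mulrA. Qed.

Lemma prod_comm (R : nzRingType) (I : Type) (b : I -> R) (i k : I) :
  b i * b k = b k * b i ->
  \prod_(l <- [:: i; k]) b l = \prod_(l <- [:: k; i]) b l.
Proof. by move=> e; rewrite !big_cons big_nil !mulr1. Qed.

Lemma ring_exp_group (G : groupType) (R : nzRingType) (f : G -> R) :
  f 1%g = 1 -> (forall v w, f v * f w = f (v * w)%g) ->
  forall w r, f w ^+ r = f (w ^+ r)%g.
Proof. by move=> f1 fM w; elim=> [|r IHr]; rewrite ?expg0 ?f1 // exprS IHr fM expgS. Qed.

Section PetersonBasis.
Variables (K : fieldType) (m : nat).
Hypothesis char2 : (2 : K) != 0.
Local Notation n := m.+2.
Local Notation W := (extW m).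
Local Notation tw := (twalg K m).
Local Notation act := (weyl_action K m).
Local Notation F := (fracS K m).
Local Notation E := (transl_alg K m).
Local Notation tproj := (@tproj K m).
Local Notation DE i := (divdiff (tconj (simple i)) (tscal (alpha K i)%:F^-1)).
Local Notation wordA := (word_op (grp act (tau m)) (@A_simple K m)).
Implicit Types (v w x : W) (i k : 'I_n) (s : seq 'I_n) (g : E).

Lemma grpX w r : grp act w ^+ r = grp act (w ^+ r)%g.
Proof. exact: (ring_exp_group (f := grp act) erefl (@grpM _ _ act)). Qed.

Lemma grp_tau_eq r r' : (tau m ^+ r = tau m ^+ r')%g ->
  grp act (tau m) ^+ r = grp act (tau m) ^+ r'.
Proof. by rewrite !grpX => ->. Qed.

Lemma A_E w : A_ K w = wordA (reduced_dec w).1 (reduced_dec w).2.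
Proof. by []. Qed.

Lemma reduced_reduced_dec w : reduced (reduced_dec w).1 (reduced_dec w).2.
Proof. by have [dE iE] := reduced_decP w; rewrite /reduced -dE. Qed.

Lemma not_minW_descent w : ~ minW w -> exists2 k : 'I_n, k != 0 & descent w k.
Proof.
move=> nm; have [/existsP[k /andP[k0 kd]]|] := boolP [exists k : 'I_n, (k != 0) && descent w k].
  by exists k.
rewrite negb_exists => /forallP nd; case: nm; apply: fin_no_descent_minW => k k0.
by have := nd k; rewrite k0.
Qed.

Lemma tproj_wordA_descent r s (k : 'I_n) : reduced r s -> k != 0 ->
  descent (tau m ^+ r * word s)%g k -> tproj (wordA r s) = 0.
Proof.
move=> rs k0 kd.
have [b ->] := word_op_descent grp_tau_eq (@A_comm K m) (A_braid char2) rs kd.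
exact: tproj_mulA.
Qed.

Lemma tproj_A_notmin w : ~ minW w -> tproj (A_ K w) = 0.
Proof.
move=> /not_minW_descent[k k0 kd]; apply: (tproj_wordA_descent (reduced_reduced_dec w) k0).
by rewrite -(reduced_decP w).1.
Qed.

(** A nonzero projection forces the word to be reduced, as its operator is nonzero, and its element
    to be minimal, as otherwise a last letter [k != 0] could be split off. Independence of the
    reduced word then identifies the operator with [A_]. *)
Lemma wordA_minW r s : tproj (wordA r s) != 0 ->
  minW (tau m ^+ r * word s)%g /\ A_ K (tau m ^+ r * word s)%g = wordA r s.
Proof.
move=> ne; have rs : reduced r s.
  apply: (word_op_neq0_reduced grp_tau_eq (@A_simple2 K m) (@A_comm K m) (A_braid char2)).
  by apply: contraNneq ne => ->; apply/eqP/proj0.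
split.
  apply: contrapT => /not_minW_descent[k k0 kd]; case/eqP: ne.
  exact: (tproj_wordA_descent rs k0).
have [dE iE] := reduced_decP (tau m ^+ r * word s)%g.
rewrite A_E; apply: (word_property grp_tau_eq (@A_comm K m) (A_braid char2)) => //.
  by apply/eqP; rewrite -(eqr_nat rat) -(eqr_pMn2r (ltn0Sn 1)) -iE rs.
by rewrite /reduced -dE.
Qed.

(** Comparing coefficients at [w] in the commutation with [a_ K i] shows that [w] fixes every
    [a_ K i], hence every index, as soon as its coefficient is nonzero. *)
Lemma Pe_transl (x : tw) : Pe x -> x \in @transl_supp K m.
Proof.
move=> [_ xC]; apply/transl_suppP => w xw; apply/transl_partP/permP => i.
rewrite perm1; apply: (a_inj char2); apply/eqP; rewrite -tofrac_eq; apply/eqP.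
rewrite -act_a; apply: (mulfI xw).
rewrite -cf_mul_scalar -xC mulr_algl cf_scale mulrC; congr (_ * _).
Qed.

Variables (j : W -> tw) (hj : peterson_basis j).

(** The projection fixes [j w], which is supported on translations, and kills all terms of
    [j w - A_ K w], which are non-minimal. *)
Lemma peterson_tproj w : minW w -> j w = tproj (A_ K w).
Proof.
move=> mw; have jE : tproj (j w) = j w.
  by apply/proj_id/transl_suppP/Pe_transl/(pb_in hj).
have [ws [c [nm e]]] := pb_lead hj mw.
apply/eqP; rewrite -jE -subr_eq0 -tprojB e; apply/eqP.
rewrite /Scomb /tproj proj_sum big_seq big1 // => x /nm /tproj_A_notmin x0.
by rewrite projZ -/tproj x0 scaler0.
Qed.

Lemma peterson_word r s : tproj (wordA r s) != 0 ->
  minW (tau m ^+ r * word s)%g /\ j (tau m ^+ r * word s)%g = tproj (wordA r s).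
Proof. by move=> /wordA_minW[mw <-]; split=> //; apply: peterson_tproj. Qed.

Lemma tproj_word s g : (0 : 'I_n) \notin s ->
  tproj (\prod_(i <- s) A_simple K i * val g) = val (foldr (fun i => DE i) g s).
Proof.
elim: s => [|i s IHs].
  by rewrite big_nil /=; move=> _; apply: (etrans (congr1 tproj (mul1r _))); apply: tproj_val.
rewrite inE negb_or eq_sym => /andP[i0 s0].
rewrite big_cons /=; apply: (etrans _ (tproj_Amul _ i0)).
apply: (etrans (congr1 tproj (esym (mulrA _ _ _)))); apply: (etrans (tproj_mul _ _)).
exact: (congr1 (fun y => tproj (A_simple K i * y)) (IHs s0)).
Qed.

(** Moving [tau ^+ r] to the right shifts every letter by [r]. If no shifted letter is 0, each acts
    as a divided difference on the monomial of [tau ^+ r]. *)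
Lemma tproj_wordA r s : (0 : 'I_n) \notin [seq i + r%:R | i <- s] ->
  tproj (wordA r s) =
  val (foldr (fun i => DE i) (tmonom K (ext_tr (tau m ^+ r)%g)) [seq i + r%:R | i <- s]).
Proof.
move=> s0; apply: (etrans (congr1 tproj (conj_word r s (@tau_A_simple K m)))).
apply: (etrans (tproj_mul _ _)); apply: (etrans _ (tproj_word _ s0)).
apply: (congr1 (fun y => tproj (_ * y))).
by apply: (etrans (congr1 tproj (grpX _ _))); apply: tproj_grp.
Qed.

(** Both sides are projections of equal products in the nilHecke algebra. *)
Lemma DE_braid i g : i != 0 -> i + 1 != 0 -> i != i + 1 + 1 ->
  DE i (DE (i + 1) (DE i g)) = DE (i + 1) (DE i (DE (i + 1) g)).
Proof.
move=> i0 i1 i2; apply: val_inj.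
have n1 : (0 : 'I_n) \notin [:: i; i + 1; i] by rewrite !inE !negb_or ![0 == _]eq_sym i0 i1.
have n2 : (0 : 'I_n) \notin [:: i + 1; i; i + 1].
  by rewrite !inE !negb_or ![0 == _]eq_sym i0 i1.
apply: (etrans (esym (tproj_word g n1))); apply: (etrans _ (tproj_word g n2)).
exact: (congr1 (fun y => tproj (y * val g)) (prod_braid (A_braid char2 i2))).
Qed.

Lemma DE_comm i k g : i != 0 -> k != 0 -> i != k -> i != k + 1 -> k != i + 1 ->
  DE i (DE k g) = DE k (DE i g).
Proof.
move=> i0 k0 ik ik' ki; apply: val_inj.
have n1 : (0 : 'I_n) \notin [:: i; k] by rewrite !inE !negb_or ![0 == _]eq_sym i0 k0.
have n2 : (0 : 'I_n) \notin [:: k; i] by rewrite !inE !negb_or ![0 == _]eq_sym i0 k0.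
apply: (etrans (esym (tproj_word g n1))); apply: (etrans _ (tproj_word g n2)).
exact: (congr1 (fun y => tproj (y * val g)) (prod_comm (A_comm K ik ik' ki))).
Qed.

End PetersonBasis.

(** * Partitions *)

Section PartitionWords.
Variable m : nat.
Local Notation n := m.+2.
Implicit Types (lam : seq nat) (k l i : nat).

Definition af_word lam : seq 'I_n :=
  flatten [seq u_word m i (nth 0%N lam i.-1) | i <- rev (iota 1 (size lam))].

Lemma w_afE lam : w_af m lam = word (af_word lam).
Proof. by []. Qed.

Lemma u_wordS i l : u_word m i l.+1 = (l.+1%:R - i%:R) :: u_word m i l.
Proof.
rewrite /u_word; have -> : iota 1 l.+1 = rcons (iota 1 l) l.+1.
  by rewrite -{1}[l.+1]addn1 iotaD cats1 add1n.
by rewrite rev_rcons.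
Qed.

Lemma af_word_cat pre l z :
  af_word (pre ++ l :: nseq z 0%N) = u_word m (size pre).+1 l ++ af_word pre.
Proof.
rewrite /af_word size_cat /= size_nseq iotaD /= add1n rev_cat rev_cons map_cat flatten_cat.
rewrite map_rcons flatten_rcons /= nth_cat ltnn subnn /=; congr (_ ++ _); last first.
  congr flatten; apply/eq_in_map => i; rewrite mem_rev mem_iota add1n ltnS => /andP[i0 il].
  by rewrite nth_cat prednK // il.
have flat0 (f : nat -> seq 'I_n) (r : seq nat) :
    {in r, forall i, f i = [::]} -> flatten [seq f i | i <- r] = [::].
  elim: r => //= i r IHr fr; rewrite fr ?mem_head // IHr // => q qr.
  by apply: fr; rewrite inE qr orbT.
rewrite flat0 // => i; rewrite mem_rev mem_iota => /andP[il _].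
rewrite nth_cat (_ : (i.-1 < size pre)%N = false); last by lia.
by case e: (i.-1 - size pre)%N => [|q] /=; [lia | rewrite nth_nseq if_same].
Qed.

Definition shift_word k lam : seq 'I_n := [seq x + k%:R | x <- af_word lam].

(** [q] counts from 0 while the column number counts from 1, as in [zminor]. *)
Definition column k lam (q : nat) : nat := (nth 0%N lam (k - q.+1) + q.+1)%N.

Definition is_partition k lam : Prop :=
  [/\ size lam = k, forall i j, (i <= j)%N -> (nth 0%N lam j <= nth 0%N lam i)%N
    & forall i, (nth 0%N lam i <= n - k)%N].

Lemma is_partitionP k lam : size lam = k -> sorted geq lam ->
  all (fun l => (l <= n - k)%N) lam -> is_partition k lam.
Proof.
move=> sz /(sorted_leq_nth (rev_trans leq_trans) leqnn 0%N) dec /all_nthP-/(_ 0%N) bd.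
split=> // [i j ij|i]; last by case: (ltnP i (size lam)) => [/bd //|h]; rewrite nth_default.
have [jl|jl] := ltnP j (size lam); last by rewrite (nth_default _ jl).
by apply: dec => //; rewrite inE ?(leq_ltn_trans ij).
Qed.

Lemma column_mono k lam q q' : is_partition k lam -> (q < q' < k)%N ->
  (column k lam q < column k lam q')%N.
Proof.
move=> [_ dec _] qq'; rewrite /column.
have := dec (k - q'.+1)%N (k - q.+1)%N; lia.
Qed.

Lemma column_bound k lam q : (k <= n)%N -> is_partition k lam -> (q < k)%N ->
  (0 < column k lam q <= n)%N.
Proof. by move=> kn [_ _ bd] qk; rewrite /column; have := bd (k - q.+1)%N; lia. Qed.

(** [lam] is [lam'] with one more box. The new letter equals the old number of the column that
    moves. That number and its successor are avoided by all other columns, so the corresponding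
    exchange affects column [q0] only. *)
Definition box_step k lam lam' (q0 : 'I_k) : Prop :=
  [/\ shift_word k lam = (column k lam' q0)%:R :: shift_word k lam',
      (0 < column k lam' q0 < n)%N, column k lam q0 = (column k lam' q0).+1,
      forall q, q != q0 -> column k lam q = column k lam' q &
      forall q, q != q0 -> column k lam' q != column k lam' q0 /\
                column k lam' q != (column k lam' q0).+1 ].

Lemma box_stepP k pre t z : (k <= n)%N ->
  let lam := pre ++ t.+1 :: nseq z 0%N in
  let lam' := pre ++ t :: nseq z 0%N in
  is_partition k lam ->
  is_partition k lam' /\ exists q0 : 'I_k, box_step lam lam' q0.
Proof.
move=> kn lam lam' pl; have [sz dec bd] := pl; set r := size pre.
have rk : (r < k)%N by rewrite -sz size_cat /= -addSnnS leq_addr.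
have nr : nth 0%N lam r = t.+1 by rewrite nth_cat ltnn subnn.
have nr' : nth 0%N lam' r = t by rewrite nth_cat ltnn subnn.
have nE i : i != r -> nth 0%N lam' i = nth 0%N lam i.
  move=> ir; rewrite !nth_cat -/r; case: ltnP => // ri.
  by case e: (i - r)%N => [|q] //; lia.
have n0 i : (r < i)%N -> nth 0%N lam i = 0%N.
  move=> ri; rewrite nth_cat -/r ltnNge (ltnW ri) /=.
  by case e: (i - r)%N => [|q] /=; [lia | rewrite nth_nseq if_same].
have pl' : is_partition k lam'.
  split; first by rewrite -sz !size_cat.
    move=> i j ij; have [ir|ir] := eqVneq i r.
      have [jr|jr] := eqVneq j r; first by rewrite jr ir.
      by rewrite nE // n0 //; lia.
    rewrite (nE i ir); apply: leq_trans (dec _ _ ij).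
    by have [->|jr] := eqVneq j r; [rewrite nr nr' | rewrite nE].
  move=> i; apply: leq_trans (bd i).
  by have [->|ir] := eqVneq i r; [rewrite nr nr' | rewrite nE].
split=> //.
have q0k : (k - r.+1 < k)%N by lia.
have kq0 : (k - (k - r.+1).+1)%N = r by lia.
exists (Ordinal q0k).
have c' : column k lam' (Ordinal q0k) = (t + (k - r))%N.
  by rewrite /column /= kq0 nr'; lia.
have c : column k lam (Ordinal q0k) = (t + (k - r)).+1.
  by rewrite /column /= kq0 nr; lia.
have cE q : q != Ordinal q0k -> column k lam q = column k lam' q.
  move=> qq; rewrite /column nE //; apply: contra_neq qq => e.
  by apply: val_inj => /=; have := ltn_ord q; lia.
have tb := bd r; rewrite nr in tb.
rewrite /box_step c' c; split=> //; last 1 first.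
- move=> q qq; have ne (mu : seq nat) : is_partition k mu -> column k mu q <> column k mu (Ordinal q0k).
    move=> pmu e; case/eqP: qq; apply/val_inj.
    have := @column_mono _ _ q (k - r.+1) pmu; have := @column_mono _ _ (k - r.+1) q pmu.
    rewrite e /= !ltnn; have := ltn_ord q; lia.
  by split; apply/eqP; [rewrite -c'|rewrite -c -(cE q qq)]; apply: ne.
(* The new box is the (t+1)-st of row r+1, so its letter shifted by [k] is [t + 1 - (r + 1) + k],
   that is [t + (k - r)]. *)
- rewrite /shift_word !af_word_cat u_wordS /=; congr (_ :: _).
  rewrite -[in LHS](subnKC (ltnW rk)) !natrD -!natr1.
  by rewrite opprD (addrACA t%:R) subrr addr0 addrA subrK.
by lia.
Qed.

Lemma seq_last_nonzero lam : lam = nseq (size lam) 0%N \/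
  exists pre t z, lam = pre ++ t.+1 :: nseq z 0%N.
Proof.
elim/last_ind: lam => [|lam [|t] IHlam]; first by left.
  case: IHlam => [e|[pre [t [z ->]]]]; [left|right].
    by rewrite size_rcons -cats1 {1}e -[[:: 0%N]]/(nseq 1 0%N) -nseqD addn1.
  exists pre, t, z.+1; rewrite rcons_cat rcons_cons -cats1.
  by rewrite -[[:: 0%N]]/(nseq 1 0%N) -nseqD addn1.
by right; exists lam, t, 0%N; rewrite cats1.
Qed.

(** The box removed is the last one of the last nonempty row, whose letter comes first in the
    word. *)
Lemma partition_ind k (P : seq nat -> Prop) : (k <= n)%N -> P (nseq k 0%N) ->
  (forall lam lam' q0, is_partition k lam' -> @box_step k lam lam' q0 -> P lam' -> P lam) ->
  forall lam, is_partition k lam -> P lam.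
Proof.
move=> kn P0 PS lam; have [N] := ubnP (sumn lam).
elim: N lam => // N IHN lam sN pl.
have [sz _ _] := pl.
have [e|[pre [t [z e]]]] := seq_last_nonzero lam; first by rewrite e sz.
rewrite e in pl sN *; have [pl' [q0 bs]] := box_stepP kn pl.
apply: PS (pl') bs _; apply: IHN pl'; move: sN.
by rewrite !sumn_cat /= addSn addnS ltnS.
Qed.

End PartitionWords.

(** * Column weights and leading monomials *)

Section ColumnWeights.
Variable m : nat.
Local Notation n := m.+2.
Implicit Types (lam : seq nat) (k : nat) (i : 'I_n) (nu mu : coweight m).

Lemma natr_inj (a b : nat) : (0 < a <= n)%N -> (0 < b <= n)%N ->
  a%:R = b%:R :> 'I_n -> a = b.
Proof.
move=> an bn /(congr1 (@nat_of_ord n)); rewrite !Zp_nat /=.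
have [->|a_n] := eqVneq a n; have [->|b_n] := eqVneq b n; rewrite ?modnn ?modn_small //; lia.
Qed.

Lemma natr_eqn (a b : nat) : (0 < a <= n)%N -> (0 < b <= n)%N ->
  (a%:R == b%:R :> 'I_n) = (a == b).
Proof. by move=> an bn; apply/eqP/eqP => [/natr_inj|->//]; apply. Qed.

Lemma shift_word0 k : shift_word m k (nseq k 0%N) = [::].
Proof.
rewrite /shift_word; case: k => // k.
by rewrite -[nseq _ _]/([::] ++ 0%N :: nseq k 0%N) af_word_cat.
Qed.

(** The exponent of the product of the [X_c] over the columns [c] of the minor. It turns out to be
    both the leading exponent of the class and the translation part of its index. *)
Definition column_weight k lam : coweight m :=
  \sum_(q < k) eps (column k lam q)%:R.

Lemma cwcoord_column_weight k lam i : cwcoord (column_weight k lam) i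
  = (\sum_(q < k) (i == (column k lam q)%:R))%N%:R - k%:R / n%:R.
Proof.
rewrite cwcoord_sum natr_sum; under [LHS]eq_bigr do rewrite cwcoord_eps.
by rewrite sumrB sumr_const card_ord mulr_natl.
Qed.

Lemma box_step_neq0 k lam lam' (q0 : 'I_k) : @box_step m k lam lam' q0 ->
  (column k lam' q0)%:R != 0 :> 'I_n.
Proof. by case=> _ /natr_neq0. Qed.

(** The columns of [lam'] contain [i] once and omit [i + 1], which gives the difference 1;
    exchanging the two indices moves just column [q0]. *)
Lemma box_step_weight k lam lam' (q0 : 'I_k) : (k <= n)%N -> is_partition m k lam' ->
  @box_step m k lam lam' q0 -> let i : 'I_n := (column k lam' q0)%:R in
  perm_coweight (tperm i (i + 1)) (column_weight k lam') = column_weight k lam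
  /\ cwcoord (column_weight k lam') i - cwcoord (column_weight k lam') (i + 1) = 1.
Proof.
move=> kn pl' [_ c0 c' cE cne] i.
have cb (q : 'I_k) := column_bound kn pl' (ltn_ord q).
have c0n : (0 < (column k lam' q0).+1 <= n)%N by case/andP: c0.
have ne (q : 'I_k) : q != q0 -> (i != (column k lam' q)%:R) * (i + 1 != (column k lam' q)%:R).
  move=> /cne[n1 n2]; rewrite /i [_ + 1]natr1 !natr_eqn ?cb //.
  by rewrite eq_sym n1 eq_sym n2.
split.
  rewrite raddf_sum; apply: eq_bigr => q _ /=; rewrite perm_eps.
  have [->|qq] := eqVneq q q0; first by rewrite tpermL c' natr1.
  by rewrite cE // tpermD //; case: (ne q qq).
rewrite !cwcoord_column_weight opprB addrA subrK.
rewrite (bigD1 q0) //= eqxx big1 ?addn0; last by move=> q /ne[/negPf ->].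
rewrite big1 ?subr0 // => q _; have [->|/ne[_ /negPf -> //]] := eqVneq q q0.
by rewrite (negPf (succ_neq _)).
Qed.

Definition minuscule nu : Prop := forall i j, cwcoord nu i - cwcoord nu j <= 1.

Lemma minuscule_column0 k : (k <= n)%N -> minuscule (column_weight k (nseq k 0%N)).
Proof.
move=> kn i i'; rewrite !cwcoord_column_weight opprB addrA subrK lerBlDr.
set s' := (\sum_(q < k) (i' == _))%N.
suff : (\sum_(q < k) (i == (column k (nseq k 0) q)%:R) <= 1)%N.
  by rewrite -(ler_nat rat) => /le_trans; apply; rewrite lerDl.
have cE (q : 'I_k) : column k (nseq k 0) q = q.+1 by rewrite /column nth_nseq if_same.
have [/existsP[q0 /eqP iq]|] := boolP [exists q : 'I_k, i == (column k (nseq k 0) q)%:R].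
  rewrite (bigD1 q0) //= iq eqxx big1 // => q qq; rewrite natr_eqn !cE ?ltn_ord //=.
  - by rewrite eqSS eq_sym val_eqE (negPf qq).
  - by rewrite (leq_trans (ltn_ord _)).
  - by rewrite (leq_trans (ltn_ord _)).
by rewrite negb_exists => /forallP ne; rewrite big1 // => q _; rewrite (negPf (ne q)).
Qed.

Definition height nu : rat := \sum_i (pos i)%:R * cwcoord nu i.

Lemma height_tperm i nu : i != 0 ->
  height (perm_coweight (tperm i (i + 1)) nu) = height nu + (cwcoord nu i - cwcoord nu (i + 1)).
Proof.
move=> i0; rewrite /height; under eq_bigr do rewrite cwcoord_perm tpermV.
have ii := succ_neq i.
rewrite (bigD1 i) //= (bigD1 (i + 1)) //= tpermL tpermR.
rewrite [in RHS](bigD1 i) //= [X in _ = _ + X + _](bigD1 (i + 1)) //=.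
rewrite (eq_bigr (fun l : 'I_n => (pos l)%:R * cwcoord nu l)) => [|l /andP[li li']].
  by rewrite pos_succS // -natr1; ring.
by rewrite tpermD // eq_sym.
Qed.

(* Exchanging i and i + 1 raises the height of a minuscule coweight by at most 1,
   so a leading term that it raises by 1 stays the leading term. *)
Definition top_term (F : fieldType) (f : coweight m -> F) mu : Prop := f mu != 0 /\
  forall nu, f nu != 0 -> minuscule nu /\ (nu = mu \/ height nu < height mu).

Lemma top_term_step (F : fieldType) (A : {rmorphism F -> F}) (c : F)
    (f h : coweight m -> F) i mu : c != 0 ->
  (forall nu, h nu = c * (A (f (perm_coweight (tperm i (i + 1)) nu)) - f nu)) ->
  i != 0 -> cwcoord mu i - cwcoord mu (i + 1) = 1 -> top_term f mu ->
  top_term h (perm_coweight (tperm i (i + 1)) mu).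
Proof.
move=> c0 hE i0 mui [fmu top].
have sK nu : perm_coweight (tperm i (i + 1)) (perm_coweight (tperm i (i + 1)) nu) = nu.
  by rewrite -perm_coweightM tperm2 perm_coweight1.
have hmu : height (perm_coweight (tperm i (i + 1)) mu) = height mu + 1.
  by rewrite height_tperm // mui.
(* This exponent is higher than the top one, so nothing in [f] cancels the image of the leading
   term. *)
have fmu' : f (perm_coweight (tperm i (i + 1)) mu) = 0.
  apply/eqP; apply: contraT => /top[_ [e|]]; last by rewrite hmu ltNge lerDl ler01.
  by move/eqP: hmu; rewrite e -subr_eq0 opprD addrA subrr sub0r oppr_eq0 oner_eq0.
split; first by rewrite hE sK fmu' subr0 mulf_neq0 // fmorph_eq0.
move=> nu; rewrite hE mulf_eq0 negb_or => /andP[_ ne].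
have [e|/top[mn hn]] := eqVneq (f nu) 0; last first.
  by split=> //; right; rewrite hmu; case: hn => [->|/lt_trans]; last apply; rewrite ltrDl ltr01.
have /top[mn hn] : f (perm_coweight (tperm i (i + 1)) nu) != 0.
  by apply: contraNneq ne => ->; rewrite e rmorph0 subr0.
split.
  by move=> a b; have := mn (tperm i (i + 1) a) (tperm i (i + 1) b); rewrite !cwcoord_perm !permK.
case: hn => [<-|hn]; first by left; rewrite sK.
right; rewrite hmu -[nu in ltLHS]sK height_tperm //.
by rewrite ltr_leD.
Qed.

End ColumnWeights.

Section TopTerm.
Variables (K : fieldType) (m : nat).
Hypothesis char2 : (2 : K) != 0.
Local Notation n := m.+2.
Local Notation W := (extW m).
Local Notation act := (weyl_action K m).
Local Notation F := (fracS K m).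
Local Notation E := (transl_alg K m).
Local Notation DE i := (divdiff (tconj (simple i)) (tscal (alpha K i)%:F^-1)).
Implicit Types (g : E) (mu nu : coweight m) (i : 'I_n).

Definition tcoef g nu : F := @monalg.mcoeff W F (transl nu) (val g).

Lemma tcoef_DE i g nu : tcoef (DE i g) nu = (alpha K i)%:F^-1 *
  (fa_act act (simple i) (tcoef g (perm_coweight (tperm i (i + 1)) nu)) - tcoef g nu).
Proof.
rewrite /tcoef /divdiff rmorphM rmorphB /=.
apply: (etrans (congr1 _ (mulr_algl _ _))); apply: (etrans (cf_scale _ _ _)); congr (_ * _).
apply: (etrans (monalg.mcoeffB _ _ _)); congr (_ - _).
have e : transl nu = (simple i * transl (perm_coweight (tperm i (i + 1)) nu) * (simple i)^-1)%g.
  by rewrite transl_conj -perm_coweightM tperm2 perm_coweight1.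
by rewrite [in LHS]e cf_grpr cf_grpl.
Qed.

Lemma tcoef_tmonom mu nu : tcoef (tmonom K mu) nu = (mu == nu)%:R.
Proof.
apply: (etrans (monalg.mcoeffU _ _ _)); congr (1 *+ nat_of_bool _).
by apply/eqP/eqP => [[]|->].
Qed.

Lemma top_term_DE i g mu : i != 0 -> cwcoord mu i - cwcoord mu (i + 1) = 1 ->
  top_term (tcoef g) mu -> top_term (tcoef (DE i g)) (perm_coweight (tperm i (i + 1)) mu).
Proof.
move=> i0 mui; apply: (top_term_step (A := fa_act act (simple i)) _ (tcoef_DE i g)) => //.
by rewrite invr_eq0 alpha_neq0.
Qed.

(** Each added box applies a divided difference that raises the leading exponent by height one, so
    the class is nonzero. *)
Lemma top_term_column k lam : (k <= n)%N -> is_partition m k lam ->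
  top_term (tcoef (foldr (fun i => DE i) (tmonom K (column_weight m k (nseq k 0%N))) (shift_word m k lam)))
           (column_weight m k lam)
  /\ (0 : 'I_n) \notin shift_word m k lam.
Proof.
move=> kn; move: lam; apply: partition_ind => //.
  rewrite shift_word0; split=> //; split=> [|nu] /=; first by rewrite tcoef_tmonom eqxx oner_eq0.
  rewrite tcoef_tmonom; have [<- _|_] := eqVneq (column_weight m k (nseq k 0%N)) nu; last by rewrite eqxx.
  by split; [apply: minuscule_column0 | left].
move=> lam lam' q0 pl' bs [top s0]; have i0 := box_step_neq0 bs.
have [mE mi] := box_step_weight kn pl' bs.
have [-> _ _ _ _] := bs; split; last by rewrite inE negb_or s0 eq_sym i0.
by rewrite -mE; apply: top_term_DE.
Qed.

End TopTerm.

(** * Comparison of minors with basis elements *)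

Section PartitionClasses.
Variables (K : fieldType) (m : nat).
Hypothesis char2 : (2 : K) != 0.
Local Notation n := m.+2.
Local Notation W := (extW m).
Local Notation tw := (twalg K m).
Local Notation act := (weyl_action K m).
Local Notation F := (fracS K m).
Local Notation E := (transl_alg K m).
Local Notation DE i := (divdiff (tconj (simple i)) (tscal (alpha K i)%:F^-1)).
Implicit Types (g : E) (i k l p q : nat) (lam : seq nat).

Lemma ext_tr_tauX_column k :
  ext_tr (tau m ^+ k)%g = column_weight m k (nseq k 0%N).
Proof.
rewrite ext_tr_tauX big_add1 big_mkord; apply: eq_bigr => q _.
by rewrite /column nth_nseq if_same.
Qed.

Lemma tauX_word k (s : seq 'I_n) :
  (tau m ^+ k * word s = word [seq x + k%:R | x <- s] * tau m ^+ k)%g.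
Proof.
elim: s => [|i s IHs]; first by rewrite !word_nil mulg1 mul1g.
by rewrite /= !word_cons mulgA tauX_simple -mulgA IHs mulgA.
Qed.

Lemma tauX_w_af k lam :
  (tau m ^+ k * w_af m lam = word (shift_word m k lam) * tau m ^+ k)%g.
Proof. exact: tauX_word. Qed.

Lemma ext_tr_w_af k lam : (k <= n)%N -> is_partition m k lam ->
  ext_tr (tau m ^+ k * w_af m lam)%g = column_weight m k lam.
Proof.
rewrite tauX_w_af => kn; move: lam; apply: partition_ind => //.
  by rewrite shift_word0 word_nil mul1g ext_tr_tauX_column.
move=> lam lam' q0 pl' bs IH; have [<- _] := box_step_weight kn pl' bs.
have := box_step_neq0 bs => i0; have [-> _ _ _ _] := bs.
by rewrite word_cons -mulgA ext_trM IH ext_tr_simple (negPf i0) add0r.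
Qed.

Definition partition_class k lam : E :=
  foldr (fun i : 'I_n => DE i) (tmonom K (column_weight m k (nseq k 0%N))) (shift_word m k lam).

Lemma tproj_partition k lam : (k <= n)%N -> is_partition m k lam ->
  let x := word_op (grp act (tau m)) (@A_simple K m) k (af_word m lam) in
  tproj x = val (partition_class k lam) /\ tproj x != 0.
Proof.
move=> kn pl x; have [[ne _] s0] := top_term_column char2 kn pl.
have e := tproj_wordA (r := k) (s := af_word m lam) K s0; rewrite ext_tr_tauX_column in e.
split; first exact: e.
rewrite /x e; apply: contraNneq ne => e0.
by rewrite /tcoef e0 monalg.mcoeff0.
Qed.

Lemma minW_w_af k lam : (k <= n)%N -> is_partition m k lam ->
  minW (tau m ^+ k * w_af m lam)%g.
Proof. by move=> kn /(tproj_partition kn)[_ /(wordA_minW char2)[]]. Qed.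

Variables (j : W -> tw) (hj : peterson_basis j).

Lemma peterson_partition k lam : (k <= n)%N -> is_partition m k lam ->
  j (tau m ^+ k * w_af m lam)%g = val (partition_class k lam).
Proof.
move=> kn /(tproj_partition kn)[<- /(peterson_word char2 hj)[_ je]].
exact: je.
Qed.

Lemma is_partition0 k : is_partition m k (nseq k 0%N).
Proof.
by split=> [|i l _|i]; rewrite ?size_nseq // !nth_nseq !if_same.
Qed.

Lemma peterson_tauX k : (k <= n)%N ->
  j (tau m ^+ k)%g = val (tmonom K (column_weight m k (nseq k 0%N))).
Proof.
move=> kn; have := peterson_partition kn (is_partition0 k).
rewrite /partition_class shift_word0 tauX_w_af shift_word0 word_nil mul1g; exact.
Qed.

Variable phi : {rmorphism CZ (@a_ K m) -> tw}.
Hypothesis phi_S : forall s : coefS K m, phi (CZ_of_S (@a_ K m) s) = s%:F%:A.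
Hypothesis phi_Pe : forall f, Pe (phi f).
Hypothesis phi_z : forall k p : nat, (1 <= k)%N -> (k + p <= n)%N ->
  phi (z_ (@a_ K m) k (k + p)) * j (tau m ^+ k.-1)%g
  = j (tau m ^+ k * c_elt m p)%g.
Local Notation Z := (z_ (@a_ K m)).

Definition phiE (f : CZ (@a_ K m)) : E := TranslAlg (Pe_transl char2 (phi_Pe f)).

Fact phiE_zmod : zmod_morphism phiE.
Proof. by move=> f g; apply: val_inj; rewrite /= rmorphB. Qed.
HB.instance Definition _ := GRing.isZmodMorphism.Build (CZ (@a_ K m)) E phiE phiE_zmod.

Fact phiE_monoid : monoid_morphism phiE.
Proof. by split=> [|f g]; apply: val_inj; rewrite /= ?rmorph1 // !rmorphM. Qed.
HB.instance Definition _ := GRing.isMonoidMorphism.Build (CZ (@a_ K m)) E phiE phiE_monoid.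

Lemma phiE_S s : phiE (CZ_of_S (@a_ K m) s) = tscal s%:F.
Proof. exact/val_inj/phi_S. Qed.

Lemma CZ_rel f : Zrel (@a_ K m) f -> (\pi_(CZ (@a_ K m)) f)%qT = 0.
Proof.
move=> Gp; apply/eqP; rewrite -[0](rmorph0 (\pi_(CZ (@a_ K m)))%qT) eqmodE /= Quotient.equivE subr0.
exact: gen_ideal_gen.
Qed.

Lemma Z_lower i l : (1 <= l < i)%N -> (i <= n)%N -> Z i l = 0.
Proof. by move=> li i_n; apply/CZ_rel/Zrel_lower. Qed.

Lemma Z_rec i l : (2 <= i <= l)%N -> (l <= n)%N -> Z i l =
  Z i.-1 l.-1 + CZ_of_S (@a_ K m) (a_ K i.-1%:R - a_ K l%:R) * Z i.-1 l.
Proof.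
move=> il l_n; apply/eqP; rewrite -subr_eq0 /z_ /CZ_of_S -rmorphM -rmorphD -rmorphB.
exact/eqP/CZ_rel/Zrel_comm.
Qed.

(** Column 0 is zero by convention, which extends the recurrence to [l = 1]. *)
Definition zE i l : E := if l is 0 then 0 else phiE (Z i l).

Local Notation aE := (fun i : nat => tscal (a_ K (i%:R : 'I_n))%:F).

(** On or above the diagonal of the new row this is the defining relation. Just below it, the only
    possibly nonzero entry on the right has coefficient [a_i - a_i]. Further below, all entries
    vanish. *)
Lemma zE_rec i l : (0 < i <= m.+1)%N -> (0 < l <= n)%N ->
  zE i.+1 l = zE i l.-1 + (aE i - aE l) * zE i l.
Proof.
case: l => // l /andP[i0 i_m] /= l_n.
have [il|li] := leqP i.+1 l.+1.
  have zr := @Z_rec i.+1 l.+1; rewrite /= ltnS i0 il in zr.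
  rewrite {zr}(zr isT l_n) (rmorphD phiE) (rmorphM phiE) /= phiE_S tofracB rmorphB.
  by case: l il l_n => //= il; lia.
rewrite Z_lower // rmorph0; have [e|ne] := eqVneq i l.+1.
  rewrite e subrr mul0r addr0; case: l e {l_n li} => //= l e.
  by rewrite Z_lower ?rmorph0 //; lia.
rewrite [Z i l.+1]Z_lower ?rmorph0 ?mulr0 ?addr0; try lia.
by case: l li ne {l_n} => //= l li ne; rewrite Z_lower ?rmorph0 //; lia.
Qed.

Definition sgE i : {rmorphism E -> E} := tconj (simple (i%:R : 'I_n)).
Definition ddcE i : E := tscal (alpha K (i%:R : 'I_n))%:F^-1.

Lemma sgE_fix i : (1 < i <= m.+1)%N -> tperm (i%:R : 'I_n) (i%:R + 1) 1 = 1.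
Proof. by move=> i1; rewrite -[1%R]/(1%:R) tpermD // ?natr1 natr_eqn //; lia. Qed.

Lemma ddcE_diff i : (0 < i <= m.+1)%N -> ddcE i * (aE i - aE i.+1) = 1.
Proof.
move=> _; rewrite -(rmorphB (@tscal K m)) -(rmorphM (@tscal K m)) -tofracB -natr1 -/(alpha _ _).
by rewrite mulVf ?alpha_neq0 // rmorph1.
Qed.

Lemma sgE_a i : (0 < i <= m.+1)%N -> sgE i (aE i) = aE i.+1.
Proof. by move=> _; rewrite /sgE /= tconj_scal act_a tpermL natr1. Qed.

Lemma sgE_a1 i : (1 < i <= m.+1)%N -> sgE i (aE 1) = aE 1.
Proof. by move=> i1; rewrite /sgE /= tconj_scal act_a sgE_fix. Qed.

Lemma sgE_x1 i : (1 < i <= m.+1)%N -> sgE i (tmonom K (eps 1)) = tmonom K (eps 1).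
Proof. by move=> i1; rewrite /sgE /= tconj_tX perm_eps sgE_fix. Qed.

Lemma divdiffE_braid i g : (0 < i)%N -> (i < m.+1)%N ->
  divdiff (sgE i) (ddcE i) (divdiff (sgE i.+1) (ddcE i.+1) (divdiff (sgE i) (ddcE i) g)) =
  divdiff (sgE i.+1) (ddcE i.+1) (divdiff (sgE i) (ddcE i) (divdiff (sgE i.+1) (ddcE i.+1) g)).
Proof.
move=> i0 im; rewrite /sgE /ddcE -natr1.
by apply: DE_braid => //; rewrite ?natr1 ?natr_neq0 ?natr_eqn //; lia.
Qed.

Lemma divdiffE_comm i l g : (0 < i)%N -> (i.+1 < l)%N -> (l <= m.+1)%N ->
  divdiff (sgE i) (ddcE i) (divdiff (sgE l) (ddcE l) g) =
  divdiff (sgE l) (ddcE l) (divdiff (sgE i) (ddcE i) g).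
Proof.
move=> i0 il lm; rewrite /sgE /ddcE.
by apply: DE_comm => //; rewrite ?natr1 ?natr_neq0 ?natr_eqn //; lia.
Qed.

Local Notation M := (divdiffs sgE ddcE aE (tmonom K (eps 1))).

Lemma partition_class_row p : partition_class 1 [:: p] = M 0 p.+1.
Proof.
rewrite /partition_class /shift_word /af_word /= cats0 -map_comp.
have -> : column_weight m 1 [:: 0%N] = eps 1 by rewrite /column_weight big_ord1.
rewrite (eq_map (g := fun t : nat => t%:R : 'I_n)) => [|t]; last by rewrite /= subrK.
elim: p => [|p IHp]; first by rewrite /= mul1r.
rewrite -{1}[p.+1]addn1 iotaD cats1 add1n rev_rcons map_cons.
exact: (congr1 (divdiff (sgE p.+1) (ddcE p.+1)) IHp).
Qed.

(** For [k = 1] the divisor is the class of the identity, which is 1, and [c_elt m p] is the element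
    of the one-row partition [[:: p]]. *)
Lemma zE_first l : (0 < l <= n)%N -> zE 1 l = M 0 l.
Proof.
case: l => // p /andP[_ pn]; rewrite -partition_class_row; apply: val_inj.
have p1 : is_partition m 1 [:: p].
  split=> // [[|i] [|l] //= _|[|i] /=]; rewrite ?nth_nil ?subn1 //.
rewrite -(peterson_partition (isT : (1 <= n)%N) p1).
have e0 : val (tmonom K (column_weight m 0 [::])) = 1 by rewrite /column_weight big_ord0 tmonom0.
have := phi_z (isT : (1 <= 1)%N) pn; rewrite add1n /= (peterson_tauX (leq0n _)) [nseq 0 _]/= e0.
have -> : c_elt m p = w_af m [:: p].
  rewrite w_afE /af_word /= cats0 /c_elt /u_word -[iota 1 p]/(iota (1 + 0) p) iotaDl -map_rev -map_comp.
  by congr word; apply: eq_map => t /=; rewrite add1n -natr1 addrK.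
by apply: etrans; apply/esym/mulr1.
Qed.

(** The case [p = 0] of [phi_z] says that [phi (Z k k)] times the class of [tau ^+ k.-1] is that of
    [tau ^+ k], so the product telescopes. *)
Lemma phiE_diag k : (k <= n)%N ->
  \prod_(p < k) phiE (Z p.+1 p.+1) = tmonom K (column_weight m k (nseq k 0%N)).
Proof.
elim: k => [_|k IHk kn]; first by rewrite big_ord0 /column_weight big_ord0 tmonom0.
rewrite big_ord_recr /= IHk ?(ltnW kn) // mulrC; apply: val_inj.
apply: (etrans (rmorphM _ _ _)).
have := phi_z (isT : (1 <= k.+1)%N) (p := 0); rewrite addn0 => /(_ kn).
by rewrite /c_elt /= word_nil mulg1 (peterson_tauX kn) (peterson_tauX (ltnW kn)).
Qed.

(** Induction on boxes. The empty partition gives a triangular matrix with the diagonal product of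
    [phiE_diag]. A further box applies the same divided difference to the minor, by [divdiff_zdet],
    and to the class, by definition. *)
Lemma phiE_zminor k lam : (k <= n)%N -> is_partition m k lam ->
  phiE (zminor (@a_ K m) lam k) = partition_class k lam.
Proof.
move=> kn pl.
have zdet_lam mu : is_partition m k mu ->
    phiE (zminor (@a_ K m) mu k) = zdet zE (fun q : 'I_k => column k mu q).
  move=> pmu; rewrite /zminor /zdet -(det_map_mx phiE); congr (\det _).
  by apply/matrixP => p q; rewrite !mxE /column addnS.
rewrite zdet_lam //; move: lam pl {zdet_lam}.
apply: partition_ind => // [|lam lam' q0 pl' bs IH].
  rewrite /partition_class shift_word0 /= -phiE_diag // /zdet -det_tr det_trig.
    by apply: eq_bigr => p _; rewrite !mxE /column nth_nseq if_same.
  apply/is_trig_mxP => p q pq; rewrite !mxE /column nth_nseq if_same add0n /=.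
  rewrite Z_lower ?rmorph0 //; last exact: leq_trans (ltn_ord q) kn.
have [sw c0 c' cE cne] := bs.
rewrite /partition_class sw /= -/(partition_class k lam') -IH.
have sgK i : (0 < i <= m.+1)%N -> involutive (sgE i) by move=> _; apply: tconj_simpleK.
have sgc i : (0 < i <= m.+1)%N -> sgE i (ddcE i) = - ddcE i by move=> _; apply: tconj_alphaV.
apply/esym/(divdiff_zdet sgK sgc ddcE_diff sgE_a sgE_a1 sgE_x1 divdiffE_braid divdiffE_comm
  (fun=> erefl) zE_first zE_rec kn) => //.
- by move=> q; case/andP: (column_bound kn pl' (ltn_ord q)).
- by move=> q /cne[].
Qed.

Lemma phi_partition k lam : (k <= n)%N -> is_partition m k lam ->
  phi (zminor (@a_ K m) lam k) = j (tau m ^+ k * w_af m lam)%g.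
Proof.
by move=> kn pl; rewrite (peterson_partition kn pl) -phiE_zminor.
Qed.

End PartitionClasses.

(** * Rectangles and the antidominant translations *)

Section Translations.
Variable m : nat.
Local Notation n := m.+2.
Local Notation W := (extW m).
Implicit Types (x y : W) (i k : 'I_n).

(** Equal translation parts mean the same coset of the finite group; two distinct minimal elements
    would each be shorter than the other. *)
Lemma minW_uniq x y : minW x -> minW y -> ext_tr x = ext_tr y -> x = y.
Proof.
move=> mx my xy; pose v : 'S_n := (ext_perm y * (ext_perm x)^-1)%g.
have e : y = (x * ExtW 0 v)%g.
  apply: extW_ext => [|i]; first by rewrite ext_trM raddf0 addr0 xy.
  by rewrite ext_permM /= /v permM permKV.
have e' : x = (y * ExtW 0 v^-1)%g.
  apply: extW_ext => [|i]; first by rewrite ext_trM raddf0 addr0 xy.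
  by rewrite ext_permM /= /v invMg invgK permM permKV.
have [v1|v1] := eqVneq v 1%g.
  by rewrite e v1 -[ExtW 0 1]/(1%g : W) mulg1.
have := mx _ v1; rewrite -e => lt1.
have v1' : v^-1%g != 1%g by rewrite invg_eq1.
by have := my _ v1'; rewrite -e' ltnNge (ltnW lt1).
Qed.

Lemma minW_transl_omega i : minW (transl (- omega i)).
Proof.
apply: fin_no_descent_minW => k k0.
rewrite /descent -leNgt /signed_inv /= !perm1 subrK !cwcoordN opprK addrC /cwcoord !mxE.
rewrite opprB addrA subrK subr_ge0 ler_nat.
have [/andP[k1 k1i]|//] := boolP (0 < (k + 1)%R <= i)%N.
have := pos_succ k; rewrite posE ifN -?lt0n // => k1E.
have k0' : (0 < k)%N by rewrite lt0n.
by rewrite k0' -k1E (leq_trans (leq_pred _)).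
Qed.

(** The columns are i+1, ..., n, and the sum of all [eps] vanishes. *)
Lemma column_weight_rect i : column_weight m (n - i) (Rpart m i) = - omega i.
Proof.
apply/eqP; rewrite -addr_eq0; apply/eqP.
have -> : omega i = \sum_(1 <= t < i.+1) eps (t%:R : 'I_n).
  rewrite (big_nat_widen _ _ n) //= big_geq_mkord omega_eps.
  by apply: eq_big => l; rewrite ?natr_val // ltnS andbC.
have -> : column_weight m (n - i) (Rpart m i) = \sum_(i.+1 <= t < n.+1) eps (t%:R : 'I_n).
  rewrite -[i.+1]add0n big_addn subSS big_mkord; apply: eq_bigr => q _.
  rewrite /column nth_nseq; congr (eps _%:R).
  by case: ifP => [_|]; have := ltn_ord q; lia.
rewrite addrC -big_cat_nat //=; last by rewrite ltnS ltnW.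
by rewrite -ext_tr_tauX tauXn.
Qed.

Lemma rect_partition (i : nat) : (i < n)%N -> is_partition m (n - i) (Rpart m i).
Proof.
move=> i_n; split; first by rewrite size_nseq.
  by move=> a b ab; rewrite !nth_nseq; case: ifP; case: ifP => //; lia.
by move=> a; rewrite nth_nseq; case: ifP => //; lia.
Qed.

Lemma RpartE (i : nat) : (0 < i < n)%N ->
  Rpart m i = nseq (n - i).-1 i ++ i.-1.+1 :: nseq 0 0%N.
Proof.
move=> /andP[i0 i_n]; rewrite prednK // /Rpart -[[:: i]]/(nseq 1 i) -nseqD addn1 prednK //.
by rewrite subn_gt0.
Qed.

Lemma Rpart1E (i : nat) : Rpart1 m i = nseq (n - i).-1 i ++ i.-1 :: nseq 0 0%N.
Proof. by rewrite cats1. Qed.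

Lemma rect1_partition (i : nat) : (0 < i < n)%N -> is_partition m (n - i) (Rpart1 m i).
Proof.
move=> i0n; have [_ i_n] := andP i0n; have := rect_partition i_n.
by rewrite RpartE // Rpart1E => /(box_stepP (leq_subr _ _))[].
Qed.

Lemma tauX_rect i : (tau m ^+ (n - i) * w_af m (Rpart m i))%g = transl (- omega i).
Proof.
have pl := rect_partition (ltn_ord i).
apply: minW_uniq (minW_transl_omega i) _.
  (* The claim concerns the group only, so any coefficient field in which 2 is nonzero may be
     used. *)
  by apply: (@minW_w_af rat) => //; apply: leq_subr.
by rewrite ext_tr_w_af ?leq_subr // column_weight_rect.
Qed.

(** The last box of the last column sits in row n-i and column i, so its letter, shifted by n-i, is
    [i]. Removing this box cancels a left factor [simple i]. *)
Lemma tauX_rect1 i : (0 < i)%N ->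
  (tau m ^+ (n - i) * w_af m (Rpart1 m i))%g = (simple i * transl (- omega i))%g.
Proof.
move=> i0; have i0n : (0 < i < n)%N by rewrite i0 /=.
apply: (mulgI (simple i)); rewrite [RHS]mulgA simple2 mul1g -tauX_rect RpartE // Rpart1E.
rewrite !w_afE !af_word_cat u_wordS /= word_cons [RHS]mulgA tauX_simple -[RHS]mulgA.
rewrite size_nseq !prednK ?subn_gt0 //.
by rewrite subrK natr_val.
Qed.

End Translations.

(** The quotient by the class of [tau ^+ k.-1] is cleared in [phi_z], that class being a unit. The
    target of [phi] is the whole twisted algebra, and [phi_onto] makes [Pe] its image. *)
Theorem proposition27 (R : realType) (m : nat)
    (j : extW m -> twalg R[i] m)
    (phi : {rmorphism CZ (@a_ R[i] m) -> twalg R[i] m})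
    (hj : peterson_basis j)
    (phi_S : forall s : coefS R[i] m, phi (CZ_of_S (@a_ R[i] m) s) = s%:F%:A)
    (phi_inj : injective phi)
    (phi_onto : forall x : twalg R[i] m, Pe x <-> exists f, phi f = x)
    (phi_z : forall k p : nat, (1 <= k)%N -> (k + p <= m.+2)%N ->
      phi (z_ (@a_ R[i] m) k (k + p)) * j (tau m ^+ k.-1)%g
      = j (tau m ^+ k * c_elt m p)%g) :
  (forall (k : nat) (lam : seq nat), (k <= m.+2)%N ->
     size lam = k -> sorted geq lam -> all (fun l => (l <= m.+2 - k)%N) lam ->
     phi (zminor (@a_ R[i] m) lam k) = j (tau m ^+ k * w_af m lam)%g)
  /\ (forall i : 'I_m.+2,
        phi (D_ (@a_ R[i] m) i) = j (transl (- omega i)))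
  /\ (forall i : 'I_m.+2, (1 <= i)%N ->
        phi (D'_ (@a_ R[i] m) i) = j (simple i * transl (- omega i)%R)%g).
Proof.
have char2 : (2 : R[i]) != 0 by rewrite pnatr_eq0.
have phi_Pe f : Pe (phi f) by apply/phi_onto; exists f.
have main k lam := phi_partition char2 hj phi_S phi_Pe phi_z (k := k) (lam := lam).
split=> [k lam kn sz srt bd|]; first by apply: main => //; apply: is_partitionP.
split=> [i|i i1].
  by rewrite /D_ main ?leq_subr ?tauX_rect //; apply: rect_partition.
by rewrite /D'_ main ?leq_subr ?tauX_rect1 //; apply: rect1_partition; rewrite i1 /=.
Qed.
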